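(* Let $n$ be a positive integer and let $\widetilde T_n\in\mathcal R_n$ satisfy both condition (A) and condition (B) below. Then: (i) for every right $\Gamma$-coset $K=M_0\Gamma\subset\mathcal M_n$ (with $M_0\in\mathcal M_n$) we have $\langle\widetilde T_n,K\rangle=-1$; (ii) for every $\Gamma$-conjugacy class $X=\{\gamma^{-1}M_0\gamma:\gamma\in\Gamma\}\subset\mathcal M_n$ we have $\langle\widetilde T_n,X\rangle=w(X)$.
   Context: Let $\Gamma=\mathrm{PSL}_2(\mathbb Z)$ and $S=\pm\begin{pmatrix}0&-1\\1&0\end{pmatrix}$, $U=\pm\begin{pmatrix}1&-1\\1&0\end{pmatrix}$, $T=US=\pm\begin{pmatrix}1&1\\0&1\end{pmatrix}$. For $n\ge1$ let $\mathcal M_n$ be the set of $2\times2$ integer matrices of determinant $n$ modulo $\{\pm1\}$, and $\mathcal R_n=\mathbb Q[\mathcal M_n]$ the $\mathbb Q$-vector space of formal finite linear combinations of elements of $\mathcal M_n$; multiplication of matrices extends bilinearly, so $\mathcal R_1=\mathbb Q[\Gamma]$ acts on $\mathcal R_n$ on the left and on the right ($1$ denotes the identity matrix). For $\xi=\sum c_MM\in\mathcal R_n$ and a subset $\mathcal S\subset\mathcal M_n$ set $\langle\xi,\mathcal S\rangle=\sum_{M\in\mathcal S}c_M$. Let $T_n^\infty=\sum_{M\in\mathcal M_n^\infty}M$, where $\mathcal M_n^\infty\subset\mathcal M_n$ is a set of representatives of $\Gamma\backslash\mathcal M_n$ consisting of matrices fixing $\infty$ (lower-left entry $0$). Condition (A):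 $(1-S)\widetilde T_n-T_n^\infty(1-S)\in(1-T)\mathcal R_n$. Condition (B): $\widetilde T_n(1+S)\in(1+U+U^2)\mathcal R_n$ and $\widetilde T_n(1+U+U^2)\in(1+S)\mathcal R_n$. Weights: for $M\in\mathcal M_n$ let $\Gamma_M$ be its centralizer in $\Gamma$. Define $w(M)=1/6$ if $M$ is scalar ($M=\pm\sqrt n I_2$); $w(M)=-1/|\Gamma_M|$ if $M$ is elliptic ($\operatorname{tr}(M)^2<4n$); $w(M)=1$ if $M$ is split hyperbolic ($\operatorname{tr}(M)^2-4n$ a positive perfect square); $w(M)=0$ if $M$ is non-split hyperbolic ($\operatorname{tr}(M)^2-4n$ positive, not a square) or parabolic ($\operatorname{tr}(M)^2=4n$, $M$ not scalar). This depends only on the conjugacy class $X$ of $M$, written $w(X)$. *)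

(* Defs.v *)
From HB Require Import structures.
From mathcomp Require Import all_boot all_order all_algebra.
From mathcomp Require Import finmap generic_quotient.
From mathcomp Require Import boolp classical_sets functions cardinality fsbigop.
From mathcomp Require Import monalg.

Set Implicit Arguments.
Unset Strict Implicit.
Unset Printing Implicit Defensive.

Import Order.TTheory GRing.Theory Num.Theory.
Local Open Scope classical_set_scope.
Local Open Scope fset_scope.
Local Open Scope ring_scope.

(* [monalg] only makes [{malg R[K]}] a ring when [K] is a [monomType], i.e. a
   monoid without nontrivial units, which excludes groups; hence the alias,
   which carries the convolution product for any monoid. *)

Definition monoid_alg (G : monoidType) (R : nzRingType) := {malg R[G]}.

HB.instance Definition _ (G : monoidType) (R : nzRingType) :=
  GRing.Lmodule.copy (monoid_alg G R) {malg R[G]}.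

Definition basis_elt (G : monoidType) (R : nzRingType) (k : G) :
  monoid_alg G R := << k >>.
Arguments basis_elt {G} R k.

Section MonoidAlgebra.
Variables (G : monoidType) (R : nzRingType).
Implicit Types g : monoid_alg G R.

Definition monoid_alg_mul g1 g2 : monoid_alg G R :=
  \sum_(k1 <- msupp g1) \sum_(k2 <- msupp g2)
     << g1@_k1 * g2@_k2 *g (k1 * k2)%g >>.

Let mulw (d1 d2 : {fset G}) g1 g2 :
  msupp g1 `<=` d1 -> msupp g2 `<=` d2 ->
  monoid_alg_mul g1 g2 =
  \sum_(k1 <- d1) \sum_(k2 <- d2) << g1@_k1 * g2@_k2 *g (k1 * k2)%g >>.
Proof.
move=> le_d1 le_d2; rewrite /monoid_alg_mul (big_fset_incl _ le_d1) /=.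
  apply/eq_bigr=> k1 _; apply/big_fset_incl => // k _ /mcoeff_outdom ->.
  by rewrite mulr0 monalgU0.
move=> k _ /mcoeff_outdom g1k.
by rewrite big1 => // k' _; rewrite g1k mul0r monalgU0.
Qed.

Lemma monoid_alg_mulUU (c1 c2 : R) (k1 k2 : G) :
  monoid_alg_mul << c1 *g k1 >> << c2 *g k2 >> = << c1 * c2 *g (k1 * k2)%g >>.
Proof. by rewrite (mulw msuppU_le msuppU_le) !big_seq_fset1 !mcoeffUU. Qed.

Let mulDl : left_distributive monoid_alg_mul +%R.
Proof.
move=> g1 g2 g; rewrite (mulw (msuppD_le g1 g2) (fsubset_refl (msupp g))).
rewrite (mulw (fsubsetUl _ (msupp g2)) (fsubset_refl (msupp g))).
rewrite (mulw (fsubsetUr (msupp g1) _) (fsubset_refl (msupp g))).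
rewrite -big_split /=; apply/eq_bigr=> k1 _.
rewrite -big_split /=; apply/eq_bigr=> k2 _.
by rewrite mcoeffD mulrDl monalgUD.
Qed.

Let mulDr : right_distributive monoid_alg_mul +%R.
Proof.
move=> g g1 g2; rewrite (mulw (fsubset_refl (msupp g)) (msuppD_le g1 g2)).
rewrite (mulw (fsubset_refl (msupp g)) (fsubsetUl _ (msupp g2))).
rewrite (mulw (fsubset_refl (msupp g)) (fsubsetUr (msupp g1) _)).
rewrite -big_split /=; apply/eq_bigr=> k1 _.
rewrite -big_split /=; apply/eq_bigr=> k2 _.
by rewrite mcoeffD mulrDr monalgUD.
Qed.

Let mul0g : left_zero 0 monoid_alg_mul.
Proof. by move=> g; rewrite /monoid_alg_mul msupp0 big_seq_fset0. Qed.

Let mulg0 : right_zero 0 monoid_alg_mul.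
Proof.
by move=> g; rewrite /monoid_alg_mul big1 // => k _; rewrite msupp0 big_seq_fset0.
Qed.

Let mul_suml I (r : seq I) (F : I -> monoid_alg G R) g :
  monoid_alg_mul (\sum_(i <- r) F i) g = \sum_(i <- r) monoid_alg_mul (F i) g.
Proof.
exact: (big_morph (fun x => monoid_alg_mul x g)
  (fun _ _ => mulDl _ _ _) (mul0g _)).
Qed.

Let mul_sumr I (r : seq I) (F : I -> monoid_alg G R) g :
  monoid_alg_mul g (\sum_(i <- r) F i) = \sum_(i <- r) monoid_alg_mul g (F i).
Proof.
exact: (big_morph (monoid_alg_mul g) (fun _ _ => mulDr _ _ _) (mulg0 _)).
Qed.

Let alg_mulgA : associative monoid_alg_mul.
Proof.
have sumE (g : monoid_alg G R) :
    exists r : seq (R * G), g = \sum_(p <- r) << p.1 *g p.2 >>.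
  by exists [seq (g@_k, k) | k <- msupp g]; rewrite big_map {1}(monalgE g).
move=> g1 g2 g3.
have [[r1 ->] [r2 ->] [r3 ->]] := And3 (sumE g1) (sumE g2) (sumE g3).
rewrite !(mul_suml r1); apply: eq_bigr => p1 _.
rewrite (mul_suml r2) !(mul_sumr r2) (mul_suml r2); apply: eq_bigr => p2 _.
rewrite !(mul_sumr r3); apply: eq_bigr => p3 _.
by rewrite !monoid_alg_mulUU mulrA mulgA.
Qed.

Let alg_mul1g : left_id (basis_elt R 1%g) monoid_alg_mul.
Proof.
move=> g; rewrite (monalgE g) mul_sumr; apply: eq_bigr => k _.
by rewrite monoid_alg_mulUU mul1r mul1g.
Qed.

Let alg_mulg1 : right_id (basis_elt R 1%g) monoid_alg_mul.
Proof.
move=> g; rewrite (monalgE g) mul_suml; apply: eq_bigr => k _.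
by rewrite monoid_alg_mulUU mulr1 mulg1.
Qed.

Let one_neq0 : basis_elt R (1%g : G) != 0.
Proof. by rewrite /basis_elt monalgU_eq0 oner_neq0. Qed.

HB.instance Definition _ := GRing.Zmodule_isNzRing.Build (monoid_alg G R)
  alg_mulgA alg_mul1g alg_mulg1 mulDl mulDr one_neq0.

Lemma basis_eltM (k1 k2 : G) :
  basis_elt R k1 * basis_elt R k2 = basis_elt R (k1 * k2)%g.
Proof. by rewrite [LHS]monoid_alg_mulUU mulr1. Qed.

End MonoidAlgebra.

(* All determinants live in one monoid [pmat] of integral matrices modulo sign,
   so that the left and right actions of [Q[Gamma]] on [R_n] are both given by
   the product of the ring [Q[pmat]], of which [R_n] is the submodule of
   elements supported in determinant [n]. *)

Definition eqsgn : rel 'M[int]_2 := fun A B => (A == B) || (A == - B).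

Lemma eqsgn_refl : reflexive eqsgn.
Proof. by move=> A; rewrite /eqsgn eqxx. Qed.

Lemma eqsgn_sym : symmetric eqsgn.
Proof. by move=> A B; rewrite /eqsgn eq_sym -eqr_oppLR [- A == B]eq_sym. Qed.

Lemma eqsgn_trans : transitive eqsgn.
Proof.
move=> B A C; rewrite /eqsgn.
by case/orP=> /eqP-> /orP[] /eqP->; rewrite ?opprK eqxx ?orbT.
Qed.

Canonical eqsgn_equiv := EquivRel eqsgn eqsgn_refl eqsgn_sym eqsgn_trans.

Definition pmat : Type := {eq_quot eqsgn}%qT.

HB.instance Definition _ := Choice.on pmat.
HB.instance Definition _ := EqQuotient.on pmat.

Definition pm (A : 'M[int]_2) : pmat := (\pi_pmat A)%qT.

Lemma pmP (A B : 'M[int]_2) : pm A = pm B <-> A = B \/ A = - B.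
Proof.
split=> [/eqP | AB].
  by rewrite eqmodE /= => /orP[] /eqP; [left | right].
by apply/eqP; rewrite eqmodE /=; apply/orP; case: AB => ->; rewrite eqxx; auto.
Qed.

Lemma reprpm (A : 'M[int]_2) : repr (pm A) = A \/ repr (pm A) = - A.
Proof. by apply/pmP; rewrite /pm reprK. Qed.

Lemma pm_repr (M : pmat) : pm (repr M) = M.
Proof. exact: reprK. Qed.

Definition pmat_mul (M N : pmat) : pmat := pm (repr M * repr N).

Lemma pmat_mul_pm (A B : 'M[int]_2) : pmat_mul (pm A) (pm B) = pm (A * B).
Proof.
apply/pmP.
by case: (reprpm A) (reprpm B) => -> [] ->; rewrite ?mulNr ?mulrN ?opprK; auto.
Qed.

Lemma pmat_mulA : associative pmat_mul.
Proof.
move=> M N P; rewrite -(pm_repr M) -(pm_repr N) -(pm_repr P).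
by rewrite !pmat_mul_pm mulrA.
Qed.

Lemma pmat_mul1m : left_id (pm 1) pmat_mul.
Proof. by move=> M; rewrite -(pm_repr M) pmat_mul_pm mul1r. Qed.

Lemma pmat_mulm1 : right_id (pm 1) pmat_mul.
Proof. by move=> M; rewrite -(pm_repr M) pmat_mul_pm mulr1. Qed.

HB.instance Definition _ :=
  isMonoid.Build pmat pmat_mulA pmat_mul1m pmat_mulm1.

Lemma pmM (A B : 'M[int]_2) : (pm A * pm B)%g = pm (A * B).
Proof. exact: pmat_mul_pm. Qed.

(* Only meaningful for determinant +-1: like [A^-1] on ['M[int]_2], the inverse
   of a non-unit is itself. *)
HB.instance Definition _ := hasInv.Build pmat (fun M => pm (repr M)^-1).

Lemma pmV (A : 'M[int]_2) : ((pm A)^-1)%g = pm A^-1.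
Proof. by apply/pmP; case: (reprpm A) => ->; rewrite ?invrN; auto. Qed.

Definition mx2 (a b c d : int) : 'M[int]_2 :=
  \matrix_(i < 2, j < 2) nth 0 (nth [::] [:: [:: a; b]; [:: c; d]] i) j.

Definition detset (n : nat) : set pmat :=
  [set pm A | A in [set A : 'M[int]_2 | \det A = n%:Z]].

Definition Gamma : set pmat := detset 1.

Definition QM : Type := monoid_alg pmat rat.
HB.instance Definition _ := GRing.NzRing.on QM.
HB.instance Definition _ := GRing.Lmodule.on QM.

Definition Rn (n : nat) : set QM :=
  [set xi | forall M, M \in msupp xi -> detset n M].

Definition eltS : QM := basis_elt rat (pm (mx2 0 (-1) 1 0)).
Definition eltU : QM := basis_elt rat (pm (mx2 1 (-1) 1 0)).
Definition eltT : QM := basis_elt rat (pm (mx2 1 1 0 1)).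

(* The sum runs over the finitely many [M] in [A] with nonzero coefficient. *)
Definition pairing (xi : QM) (A : set pmat) : rat := \sum_(M \in A) xi@_M.

Definition fixes_infty (M : pmat) : Prop := (repr M) 1 0 = 0.

(* [D] is a set of representatives of [Gamma \ M_n] fixing infinity. *)
Definition infty_reps (n : nat) (D : {fset pmat}) : Prop :=
  (forall M, M \in D -> detset n M /\ fixes_infty M) /\
  (forall M, detset n M -> exists! N, N \in D /\ exists2 g, Gamma g & N = (g * M)%g).

Definition Tinfty (D : {fset pmat}) : QM := \sum_(M <- D) basis_elt rat M.

Definition conditionA (n : nat) (D : {fset pmat}) (Tn : QM) : Prop :=
  exists2 xi, Rn n xi &
    (1 - eltS) * Tn - Tinfty D * (1 - eltS) = (1 - eltT) * xi.

Definition conditionB (n : nat) (Tn : QM) : Prop :=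
  (exists2 xi, Rn n xi &
     Tn * (1 + eltS) = (1 + eltU + eltU ^+ 2) * xi) /\
  (exists2 xi, Rn n xi &
     Tn * (1 + eltU + eltU ^+ 2) = (1 + eltS) * xi).

Definition right_coset (M0 : pmat) : set pmat := [set (M0 * g)%g | g in Gamma].

(* [(M0 ^ g)%g] is [(g^-1 * (M0 * g))%g]. *)
Definition conj_class (M0 : pmat) : set pmat := [set (M0 ^ g)%g | g in Gamma].

Definition centralizer (M : pmat) : set pmat :=
  [set g | Gamma g /\ (g * M)%g = (M * g)%g].

Definition trsq (M : pmat) : int := (\tr (repr M)) ^+ 2.

Definition scalar_pmat (M : pmat) : bool := is_scalar_mx (repr M).

Lemma trsq_pm (A : 'M[int]_2) : trsq (pm A) = (\tr A) ^+ 2.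
Proof. by rewrite /trsq; case: (reprpm A) => -> //; rewrite raddfN sqrrN. Qed.

Lemma scalar_pmat_pm (A : 'M[int]_2) : scalar_pmat (pm A) = is_scalar_mx A.
Proof.
have scN (B : 'M[int]_2) : is_scalar_mx B -> is_scalar_mx (- B).
  by move=> /is_scalar_mxP[a ->]; rewrite -raddfN scalar_mx_is_scalar.
rewrite /scalar_pmat; case: (reprpm A) => -> //.
by apply/idP/idP => /scN //; rewrite opprK.
Qed.

Lemma fixes_infty_pm (A : 'M[int]_2) : fixes_infty (pm A) <-> A 1 0 = 0.
Proof.
rewrite /fixes_infty; case: (reprpm A) => -> //; rewrite mxE.
by split=> [/eqP | ->]; rewrite ?oppr0 // oppr_eq0 => /eqP.
Qed.

Lemma detset_pm (n : nat) (A : 'M[int]_2) : detset n (pm A) <-> \det A = n%:Z.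
Proof.
split=> [[B /= dB /pmP[<- | BA]] // | dA]; last by exists A.
by rewrite -dB BA -scaleN1r detZ sqrrN expr1n mul1r.
Qed.

(* [fset_set] is the finite set underlying a finite [set]; the centralizer of an
   elliptic element is finite. *)
Definition weight (n : nat) (M : pmat) : rat :=
  if scalar_pmat M then 6%:R^-1
  else if trsq M < (4 * n)%:Z then - (#|` fset_set (centralizer M)|%:R)^-1
  else if ((4 * n)%:Z < trsq M) &&
          `[< exists k : int, trsq M - (4 * n)%:Z = k ^+ 2 >] then 1
  else 0.

(* Main.v *)
Require Import Defs.
From mathcomp Require Import all_boot all_order all_algebra.
From mathcomp Require Import finmap boolp classical_sets functions cardinality fsbigop.
From mathcomp Require Import monalg.
From mathcomp Require Import zify ring lra.
Import Order.TTheory GRing.Theory Num.Theory.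
Local Open Scope ring_scope.

(* Gamma acts simply transitively on the oriented edges of the trivalent tree
   dual to the Farey triangulation: [S] reverses an edge and [U] rotates about a
   vertex. Let F be the coefficient function of Tn. Allowing infinite supports,
   T_n^oo (1 - S) = (1 - T) chi, where chi(M) is half the sign of the side on
   which the geodesic from M 0 to M oo passes the cusp oo. Combined with (A)
   this splits F as Omega + A with Omega left [U]-invariant and A left
   [S]-invariant (a finitely supported flow without sources is zero), and (B)
   forces A(M) + A(MS) = 0 and Omega(M) + Omega(MU) + Omega(MU^2) = 1/2. So
   G = 1/2 - A satisfies G(M) + G(MS) = 1, and F is its divergence at the
   vertices of the tree, both along g |-> M0 g and along g |-> g^-1 M0 g.
   Outside a finite set G(M) is 1 or 0 according to the sign of the scalar
   product [tau M] of the columns of M.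
     A total divergence only depends on the flow at infinity, hence G may be
   replaced by any explicit flow agreeing with it almost everywhere. For cosets
   and for elliptic classes this is the flow of a positive definite form on its
   topograph, with a single sink of total weight -1 (over Gamma, hence
   -1/|Gamma_M| over an elliptic class). For the other nonscalar classes it is
   the flow of the fixed-point form of M, whose divergence vanishes except at
   one vertex, next to a cusp fixed by M, when the discriminant is a nonzero
   square. *)

Set Implicit Arguments.
Unset Strict Implicit.
Unset Printing Implicit Defensive.

(** * Integral matrices modulo sign, in coordinates *)

Section Mx2.
Implicit Types a b c d : int.

Lemma mx2E a b c d : ((mx2 a b c d 0 0 = a) * (mx2 a b c d 0 1 = b) *
  (mx2 a b c d 1 0 = c) * (mx2 a b c d 1 1 = d))%type.
Proof. by rewrite !mxE. Qed.

Lemma mx2_eta (A : 'M[int]_2) : A = mx2 (A 0 0) (A 0 1) (A 1 0) (A 1 1).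
Proof.
apply/matrixP => i j; rewrite !mxE.
case: i => [[|[|//]] hi]; case: j => [[|[|//]] hj] /=;
  by congr (A _ _); apply/val_inj.
Qed.

Lemma mx2P (A B : 'M[int]_2) :
  A 0 0 = B 0 0 -> A 0 1 = B 0 1 -> A 1 0 = B 1 0 -> A 1 1 = B 1 1 -> A = B.
Proof. by move=> h1 h2 h3 h4; rewrite (mx2_eta A) (mx2_eta B) h1 h2 h3 h4. Qed.

Lemma mx2M a b c d a' b' c' d' : mx2 a b c d * mx2 a' b' c' d' =
  mx2 (a * a' + b * c') (a * b' + b * d') (c * a' + d * c') (c * b' + d * d').
Proof. by apply: mx2P; rewrite !mxE !big_ord_recl big_ord0 !mxE addr0. Qed.

Lemma mx2N a b c d : - mx2 a b c d = mx2 (- a) (- b) (- c) (- d).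
Proof. by apply: mx2P; rewrite !mxE. Qed.

Lemma mx2_1 : mx2 1 0 0 1 = 1.
Proof. by apply: mx2P; rewrite !mxE. Qed.

Lemma det_mx2 a b c d : \det (mx2 a b c d) = a * d - b * c.
Proof.
rewrite (expand_det_row _ 0) !big_ord_recl big_ord0 /cofactor !det_mx11 !mxE /=.
by rewrite expr0 expr1 mul1r addr0 mulN1r mulrN.
Qed.

Lemma tr_mx2 a b c d : \tr (mx2 a b c d) = a + d.
Proof. by rewrite /mxtrace !big_ord_recl big_ord0 !mxE addr0. Qed.

Lemma mx2_scalar a b c d : is_scalar_mx (mx2 a b c d) = [&& b == 0, c == 0 & a == d].
Proof.
apply/is_scalar_mxP/and3P => [[x e] | [/eqP-> /eqP-> /eqP->]].
  by move/matrixP: e => e; move: (e 0 0) (e 0 1) (e 1 0) (e 1 1); rewrite !mxE /= => -> -> -> ->.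
by exists d; apply: mx2P; rewrite !mxE.
Qed.

Lemma mx2_inj a b c d a' b' c' d' : mx2 a b c d = mx2 a' b' c' d' ->
  [/\ a = a', b = b', c = c' & d = d'].
Proof.
by move/matrixP => e; move: (e 0 0) (e 0 1) (e 1 0) (e 1 1); rewrite !mx2E.
Qed.

End Mx2.

Definition pmx a b c d : pmat := pm (mx2 a b c d).

Lemma pmx_eta (M : pmat) : exists a b c d, M = pmx a b c d.
Proof.
exists (repr M 0 0), (repr M 0 1), (repr M 1 0), (repr M 1 1).
by rewrite /pmx -mx2_eta pm_repr.
Qed.

Lemma pmxM a b c d a' b' c' d' : (pmx a b c d * pmx a' b' c' d')%g =
  pmx (a * a' + b * c') (a * b' + b * d') (c * a' + d * c') (c * b' + d * d').
Proof. by rewrite /pmx pmM mx2M. Qed.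

Lemma pmxN a b c d : pmx (- a) (- b) (- c) (- d) = pmx a b c d.
Proof. by apply/pmP; right; rewrite mx2N. Qed.

Lemma pmx1 : pmx 1 0 0 1 = 1%g.
Proof. by rewrite /pmx mx2_1. Qed.

Lemma pmxP a b c d a' b' c' d' : pmx a b c d = pmx a' b' c' d' <->
  [/\ a = a', b = b', c = c' & d = d'] \/
  [/\ a = - a', b = - b', c = - c' & d = - d'].
Proof.
split=> [/pmP[/mx2_inj|] |]; first by left.
  by rewrite mx2N => /mx2_inj; right.
by case=> -[-> -> -> ->]; rewrite ?pmxN.
Qed.

Lemma detset_pmx n a b c d : detset n (pmx a b c d) <-> a * d - b * c = n%:Z.
Proof. by rewrite -det_mx2; exact: detset_pm. Qed.

Lemma detsetP n M : detset n M ->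
  exists a b c d, M = pmx a b c d /\ a * d - b * c = n%:Z.
Proof.
by have [a [b [c [d ->]]]] := pmx_eta M => /detset_pmx h; exists a, b, c, d.
Qed.

Lemma detsetM m n M N : detset m M -> detset n N -> detset (m * n) (M * N)%g.
Proof.
move=> /detsetP[a [b [c [d [-> h]]]]] /detsetP[a' [b' [c' [d' [-> h']]]]].
by rewrite pmxM; apply/detset_pmx; rewrite PoszM -h -h'; ring.
Qed.

Lemma pmxV x y z w : x * w - y * z = 1 -> ((pmx x y z w)^-1)%g = pmx w (- y) (- z) x.
Proof.
move=> h; rewrite /pmx pmV; congr pm.
have e : mx2 x y z w * mx2 w (- y) (- z) x = 1.
  by rewrite mx2M -mx2_1; congr mx2; lia.
have e' : mx2 w (- y) (- z) x * mx2 x y z w = 1.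
  by rewrite mx2M -mx2_1; congr mx2; lia.
have u : mx2 x y z w \is a GRing.unit by apply/unitrP; exists (mx2 w (- y) (- z) x).
by rewrite -[LHS]mulr1 -e mulKr.
Qed.

(** Evaluated at the chosen representative, hence meaningful only for an [f] unchanged when all four
    entries change sign, as [entry_funE] requires. *)
Definition entry_fun (R : Type) (f : int -> int -> int -> int -> R) (M : pmat) : R :=
  f (repr M 0 0) (repr M 0 1) (repr M 1 0) (repr M 1 1).

Lemma entry_funE (R : Type) f :
  (forall a b c d, f (- a) (- b) (- c) (- d) = f a b c d :> R) ->
  forall a b c d, entry_fun f (pmx a b c d) = f a b c d.
Proof.
move=> fN a b c d; rewrite /entry_fun /pmx.
by case: (reprpm (mx2 a b c d)) => ->; rewrite ?mx2N !mx2E.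
Qed.

Local Notation pS := (pmx 0 (-1) 1 0).
Local Notation pU := (pmx 1 (-1) 1 0).
Local Notation pT := (pmx 1 1 0 1).
Local Notation pL := (pmx 1 0 1 1).

Lemma Gamma_unit g : Gamma g -> (g^-1 * g)%g = 1%g /\ (g * g^-1)%g = 1%g.
Proof.
move=> /detsetP[x [y [z [w [-> h]]]]]; rewrite (pmxV h) !pmxM -pmx1.
by split; congr pmx; lia.
Qed.

Lemma GammaV g : Gamma g -> Gamma g^-1%g.
Proof.
move=> /detsetP[x [y [z [w [-> h]]]]]; rewrite (pmxV h); apply/detset_pmx; lia.
Qed.

Lemma GammaM g h : Gamma g -> Gamma h -> Gamma (g * h)%g.
Proof. exact: (@detsetM 1 1). Qed.

Lemma GammaMl n g N : Gamma g -> detset n N -> detset n (g * N)%g.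
Proof. by move=> hg hN; rewrite -(mul1n n); apply: detsetM. Qed.

Lemma GammaMr n g N : Gamma g -> detset n N -> detset n (N * g)%g.
Proof. by move=> hg hN; rewrite -(muln1 n); apply: detsetM. Qed.

Lemma Gamma1 : Gamma 1%g.
Proof. by rewrite -pmx1; apply/detset_pmx. Qed.
Lemma GammaS : Gamma pS. Proof. exact/detset_pmx. Qed.
Lemma GammaU : Gamma pU. Proof. exact/detset_pmx. Qed.
(** Finiteness of sets of matrices is reduced to bounds on this norm. *)
Definition pnorm : pmat -> nat :=
  entry_fun (fun a b c d => `|a| + `|b| + `|c| + `|d|)%N.

Lemma pnormE a b c d : pnorm (pmx a b c d) = (`|a| + `|b| + `|c| + `|d|)%N.
Proof. by apply: entry_funE => *; rewrite !abszN. Qed.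

Lemma pnormM M N : (pnorm (M * N)%g <= pnorm M * pnorm N)%N.
Proof.
have [a [b [c [d ->]]]] := pmx_eta M; have [x [y [z [w ->]]]] := pmx_eta N.
rewrite pmxM !pnormE; 
have H (u v u' v' : int) : (`|(u * v + u' * v')%R| <= `|u| * `|v| + `|u'| * `|v'|)%N.
  by rewrite -!abszM; lia.
move: (H a x b z) (H a y b w) (H c x d z) (H c y d w).
rewrite !mulnDl !mulnDr; lia.
Qed.

Lemma finite_pnorm_le B : finite_set [set M | (pnorm M <= B)%N].
Proof.
pose r := [seq k%:Z - B%:Z | k <- iota 0 (2 * B).+1].
have rP (x : int) : (`|x| <= B)%N -> x \in r.
  move=> h; apply/mapP; exists `|(x + B%:Z)%R|%N; last by lia.
  by rewrite mem_iota; lia.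
pose l := [seq pmx p.1.1 p.1.2 p.2.1 p.2.2 | p <-
  [seq (p, q) | p <- [seq (a, b) | a <- r, b <- r], q <- [seq (a, b) | a <- r, b <- r]]].
apply: (@sub_finite_set _ _ [set` l]); last exact: finite_seq.
move=> M /=; have [a [b [c [d ->]]]] := pmx_eta M; rewrite pnormE => h.
apply/mapP; exists ((a, b), (c, d)) => //.
by apply: allpairs_f; apply: allpairs_f; apply: rP; lia.
Qed.

Lemma finite_pnorm_bound (E : set pmat) : finite_set E ->
  exists B, forall M, E M -> (pnorm M <= B)%N.
Proof.
move=> /finite_seqP[s ->]; exists (\max_(M <- s) pnorm M) => M /= Ms.
exact: (@leq_bigmax_seq _ s xpredT pnorm).
Qed.

Lemma finite_sub_pnorm (E : set pmat) B :
  (forall M, E M -> (pnorm M <= B)%N) -> finite_set E.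
Proof. by move=> h; apply: sub_finite_set (finite_pnorm_le B). Qed.

(** Multiplying [g N] by the adjugate of [N], which has the same norm as [N], gives [n g]. *)
Lemma pnorm_mulr n g N : (0 < n)%N -> detset n N ->
  (pnorm g <= pnorm (g * N)%g * pnorm N)%N.
Proof.
move=> n0 /detsetP[a [b [c [d [-> h]]]]].
have -> : pnorm (pmx a b c d) = pnorm (pmx d (- b) (- c) a).
  by rewrite !pnormE !abszN; lia.
apply: leq_trans (pnormM _ _); rewrite -mulgA pmxM.
have -> : pmx (a * d + b * - c) (a * - b + b * a) (c * d + d * - c) (c * - b + d * a)
  = pmx n%:Z 0 0 n%:Z by congr pmx; lia.
have [x [y [z [w ->]]]] := pmx_eta g; rewrite pmxM !pnormE !mulr0 !addr0 !add0r !abszM /=.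
by nia.
Qed.

(** * Finitely supported sums over infinite sets *)

Definition fin_supp (T : choiceType) (X : set T) (f : T -> rat) :=
  finite_set [set x | X x /\ f x != 0].

Section FinSum.
Variables (T : choiceType) (X : set T).
Implicit Types f g : T -> rat.

Lemma fsumW (W : set T) f : (W `<=` X)%classic -> (forall x, X x -> f x != 0 -> W x) ->
  \sum_(x \in X) f x = \sum_(x \in W) f x.
Proof.
move=> WX h; symmetry; apply: fsbig_widen => // x [Xx nWx] /=.
by apply/eqP; apply: contra_notT nWx => /h; apply.
Qed.

Lemma fsumD f g : fin_supp X f -> fin_supp X g ->
  \sum_(x \in X) (f x + g x) = \sum_(x \in X) f x + \sum_(x \in X) g x.
Proof.
move=> ff fg; pose W : set T := ([set x | X x /\ f x != 0] `|` [set x | X x /\ g x != 0])%classic.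
have fW : finite_set W by rewrite finite_setU.
have WX : (W `<=` X)%classic by move=> x [[]|[]].
rewrite (fsumW WX) ?(fsumW (f := f) WX) ?(fsumW (f := g) WX) ?fsbig_split //.
- by move=> x Xx h; right.
- by move=> x Xx h; left.
- move=> x Xx; case: (eqVneq (f x) 0) => [->|]; last by left.
  by rewrite add0r; right.
Qed.

Lemma fsumZ a f : fin_supp X f ->
  \sum_(x \in X) (a * f x) = a * \sum_(x \in X) f x.
Proof.
move=> ff; rewrite full_fsbig_distrr //.
by apply: sub_finite_set ff => x [Xx /eqP h].
Qed.

Lemma finite_bij_preimage (Y : set T) (h : T -> T) : set_bij X X h ->
  finite_set [set x | X x /\ Y x] -> finite_set [set x | X x /\ Y (h x)].
Proof.
case=> hX hinj _ fY.
(* [h] is injective only on [X]; recording membership in [X] discards the points outside [X] that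
   [h] may send into it. *)
pose h' x := (h x, `[< X x >]).
apply: (@sub_finite_set _ _ (h' @^-1` ([set x | X x /\ Y x] `*` [set true])))%classic.
  by move=> x [Xx Yx]; split=> /=; [split=> //; exact: (hX _ Xx)|exact/asboolP].
apply: finite_preimage; last exact: finite_setX.
move=> x y /set_mem [_ /= /asboolP Xx] /set_mem [_ /= /asboolP Xy] [e _].
by apply: hinj e; rewrite inE.
Qed.

Lemma fin_supp_bij f h : set_bij X X h -> fin_supp X f -> fin_supp X (fun x => f (h x)).
Proof. by move=> hb ff; apply: (@finite_bij_preimage (fun x => f x != 0)). Qed.

Lemma fsum_bij f h : set_bij X X h -> \sum_(x \in X) f (h x) = \sum_(x \in X) f x.
Proof. by move=> hb; rewrite [RHS](reindex_fsbig h X X). Qed.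

(** A sum with infinite support is 0 by default, so the value is carried together with the support
    condition. *)
Definition has_fsum f v := fin_supp X f /\ \sum_(x \in X) f x = v.

Lemma has_fsumD f g v w : has_fsum f v -> has_fsum g w ->
  has_fsum (fun x => f x + g x) (v + w).
Proof.
move=> [ff fv] [fg gw]; split; last by rewrite fsumD // fv gw.
apply: sub_finite_set (_ : finite_set ([set x | X x /\ f x != 0] `|`
  [set x | X x /\ g x != 0])%classic); last by rewrite finite_setU.
move=> x [Xx]; case: (eqVneq (f x) 0) => [->|]; last by left.
by rewrite add0r; right.
Qed.

Lemma has_fsumN f v : has_fsum f v -> has_fsum (fun x => - f x) (- v).
Proof.
move=> [ff fv]; split.
  by apply: sub_finite_set ff => x [Xx]; rewrite oppr_eq0.
rewrite -fv -mulN1r -fsumZ //.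
by apply: eq_fsbigr => x _; rewrite mulN1r.
Qed.

Lemma has_fsum_bij f h v : set_bij X X h -> has_fsum f v -> has_fsum (fun x => f (h x)) v.
Proof. by move=> hb [ff <-]; split; [exact: fin_supp_bij|rewrite fsum_bij]. Qed.

Lemma has_fsum_unique f g v w : (forall x, X x -> f x = g x) ->
  has_fsum f v -> has_fsum g w -> v = w.
Proof. by move=> fg [_ <-] [_ <-]; apply: eq_fsbigr => x /set_mem /fg. Qed.

(* [G] is a flow on oriented edges with divergence [f] at the vertices; only the
   behaviour of the flow at infinity determines the total divergence. *)
Lemma fsum_flow (s u : T -> T) f G G' :
  set_bij X X s -> set_bij X X u ->
  (forall x, X x -> f x + f (u x) + f (u (u x)) = G (s (u x)) + G (s (u (u x))) - G x) ->
  (forall x, X x -> G x + G (s x) = 1) ->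
  (forall x, X x -> G' x + G' (s x) = 1) ->
  fin_supp X f -> finite_set [set x | X x /\ G x != G' x] ->
  \sum_(x \in X) (G' (s (u x)) + G' (s (u (u x))) - G' x) = 3 * \sum_(x \in X) f x.
Proof.
move=> sb ub fG Gs Gs' ff fd.
have Xs x : X x -> X (s x) by case: sb => + _ _; apply.
have Xu x : X x -> X (u x) by case: ub => + _ _; apply.
pose d x := G x - G' x; pose v := \sum_(x \in X) d x; pose w := \sum_(x \in X) f x.
have hd : has_fsum d v.
  by split=> //; apply: sub_finite_set fd => x [Xx]; rewrite subr_eq0.
have hf : has_fsum f w by [].
have hds := has_fsum_bij sb hd.
have hdsu := has_fsum_bij ub hds.
have hdsuu := has_fsum_bij ub hdsu.
have hfu := has_fsum_bij ub hf.
have hfuu := has_fsum_bij ub hfu.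
(* Both flows obey the same reversal rule, so [d x + d (s x) = 0]. *)
have v0 : v + v = 0.
  apply: has_fsum_unique (has_fsumD hd hds) _.
    move=> x Xx; have := Gs x Xx; have := Gs' x Xx; rewrite /d.
    instantiate (1 := fun=> 0); move=> /= h1 h2; lra.
  split; last by apply: fsbig1.
  by apply: sub_finite_set (finite_set0 T) => x []; rewrite eqxx.
have h := has_fsumD (has_fsumD (has_fsumD hf hfu) hfuu)
  (has_fsumD (has_fsumD hd (has_fsumN hdsu)) (has_fsumN hdsuu)).
transitivity (w + w + w + (v + - v + - v)); last first.
  by rewrite -/w; lra.
case: h => _ <-; apply: eq_fsbigr => x /set_mem Xx.
by have := fG x Xx; rewrite /d /=; lra.
Qed.

End FinSum.

(** * The actions of [S] and [U], and functions on the tree *)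

Lemma S_mul a b c d : (pS * pmx a b c d)%g = pmx (- c) (- d) a b.
Proof. by rewrite pmxM; congr pmx; lia. Qed.
Lemma mul_S a b c d : (pmx a b c d * pS)%g = pmx b (- a) d (- c).
Proof. by rewrite pmxM; congr pmx; lia. Qed.
Lemma mul_U a b c d : (pmx a b c d * pU)%g = pmx (a + b) (- a) (c + d) (- c).
Proof. by rewrite pmxM; congr pmx; lia. Qed.
Lemma U_mul a b c d : (pU * pmx a b c d)%g = pmx (a - c) (b - d) a b.
Proof. by rewrite pmxM; congr pmx; lia. Qed.

Lemma S_mulA a b c d N : (pS * (pmx a b c d * N))%g = (pmx (- c) (- d) a b * N)%g.
Proof. by rewrite mulgA S_mul. Qed.
Lemma U_mulA a b c d N : (pU * (pmx a b c d * N))%g = (pmx (a - c) (b - d) a b * N)%g.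
Proof. by rewrite mulgA U_mul. Qed.

(* The scalar product of the two columns; it is left [S]-invariant and
   asymptotically decides on which side of the geodesic from [N 0] to [N oo] the
   base triangle lies. *)
Definition tau : pmat -> int := entry_fun (fun a b c d => a * b + c * d).

Lemma tauE a b c d : tau (pmx a b c d) = a * b + c * d.
Proof. by apply: entry_funE => *; rewrite !mulrNN. Qed.

Lemma tau_Sl N : tau (pS * N)%g = tau N.
Proof. by have [a [b [c [d ->]]]] := pmx_eta N; rewrite S_mul !tauE; lia. Qed.

Lemma tau_Sr N : tau (N * pS)%g = - tau N.
Proof. by have [a [b [c [d ->]]]] := pmx_eta N; rewrite mul_S !tauE; lia. Qed.

Lemma SSl N : (pS * (pS * N))%g = N.
Proof.
by have [a [b [c [d ->]]]] := pmx_eta N; rewrite !S_mul -pmxN; congr pmx; lia.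
Qed.

Lemma UUUl N : (pU * (pU * (pU * N)))%g = N.
Proof.
have [a [b [c [d ->]]]] := pmx_eta N; rewrite !U_mul -pmxN; congr pmx; lia.
Qed.

Lemma UUUr N : (N * pU * pU * pU)%g = N.
Proof.
have [a [b [c [d ->]]]] := pmx_eta N; rewrite !mul_U -pmxN; congr pmx; lia.
Qed.

(* A finitely supported flow through the trivalent tree with no source vanishes:
   otherwise it could be followed away to infinity. *)
Lemma flow_vanish n (z : pmat -> rat) : (0 < n)%N ->
  finite_set [set N | detset n N /\ z N != 0] ->
  (forall N, detset n N -> z (pS * N)%g = - z N) ->
  (forall N, detset n N -> z N + z (pU * N)%g + z (pU * (pU * N))%g = 0) ->
  forall N, detset n N -> z N = 0.
Proof.
move=> n0 fz zS zU N hN; apply/eqP; apply: contraT => zN.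
have grow k : exists x y v w : int, [/\ 0 <= x, 0 <= y, 0 <= v & 0 <= w] /\
    [/\ x * w - y * v = 1, k%:Z <= x + y + v + w & z (pmx x y v w * N)%g != 0].
  elim: k => [|k [x [y [v [w [[x0 y0 v0 w0] [h1 hk hz]]]]]]].
    by exists 1, 0, 0, 1; split; [|rewrite pmx1 mul1g].
  have hM : detset n (pmx x y v w * N)%g by apply: GammaMl => //; apply/detset_pmx.
  have hSM : detset n (pS * (pmx x y v w * N))%g by apply: GammaMl => //; exact: GammaS.
  (* The flow through the current edge continues into at least one of the two next edges; these are
     reached by adding one row of the nonnegative matrix to the other, so the sum of its entries
     grows. *)
  move: (zU _ hSM); rewrite (zS _ hM).
  rewrite S_mulA !(U_mulA _ _ _ _ N) => e.
  have [eL|eT] := eqVneq (z (pmx (- v - x) (- w - y) (- v) (- w) * N)%g) 0.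
  - exists x, y, (x + v), (y + w); split; first by split; lia.
    have -> : pmx x y (x + v) (y + w) = pmx (- v - x - - v) (- w - y - - w) (- v - x) (- w - y).
      by rewrite -pmxN; congr pmx; lia.
    split; [lia|nia|].
    by apply: contra_neq hz => e0; move: e; rewrite e0 eL; lra.
  - exists (x + v), (y + w), v, w; split; first by split; lia.
    rewrite -[pmx (x + v) _ _ _]pmxN.
    by split; [lia|nia|]; rewrite !opprD addrC [- y - w]addrC.
have [B hB] := finite_pnorm_bound fz.
have [x [y [v [w [[x0 y0 v0 w0] [h1 hk hz]]]]]] := grow (B * pnorm N).+1.
have hM : detset n (pmx x y v w * N)%g by apply: GammaMl => //; apply/detset_pmx.
have := pnorm_mulr (pmx x y v w) n0 hN.
have := hB _ (conj hM hz); rewrite pnormE => h3.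
have : (pnorm (pmx x y v w * N)%g * pnorm N <= B * pnorm N)%N by rewrite leq_mul2r h3 orbT.
move: hk; lia.
Qed.

(** Up to sign [U U S] is [pmx 1 0 1 1], so [z] is constant along the powers of this matrix applied
    to [N]. These leave every finite set, in particular the one where [z] differs from [k]. *)
Lemma inv_const n (z : pmat -> rat) k : (0 < n)%N ->
  finite_set [set N | detset n N /\ z N != k] ->
  (forall N, detset n N -> z (pS * N)%g = z N) ->
  (forall N, detset n N -> z (pU * N)%g = z N) ->
  forall N, detset n N -> z N = k.
Proof.
move=> n0 fz zS zU N hN.
have hL (m : nat) : detset n (pmx 1 0 m%:Z 1 * N)%g.
  by apply: GammaMl => //; apply/detset_pmx; lia.
have zL (m : nat) : z (pmx 1 0 m%:Z 1 * N)%g = z N.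
  elim: m => [|m <-]; first by rewrite pmx1 mul1g.
  have h1 : detset n (pS * (pmx 1 0 m%:Z 1 * N))%g by apply: GammaMl => //; exact: GammaS.
  have h2 : detset n (pU * (pS * (pmx 1 0 m%:Z 1 * N)))%g by apply: GammaMl => //; exact: GammaU.
  rewrite -(zS _ (hL m)) -(zU _ h1) -(zU _ h2) S_mulA !(U_mulA _ _ _ _ N).
  by congr (z (_ * N)%g); rewrite -pmxN; congr pmx; lia.
have [B hB] := finite_pnorm_bound fz.
apply/eqP; apply: contraT => zN.
have := pnorm_mulr (pmx 1 0 (B * pnorm N)%N 1) n0 hN.
have := hB (pmx 1 0 (B * pnorm N)%N 1 * N)%g; rewrite /= zL => /(_ (conj (hL _) zN)).
rewrite pnormE => h3.
have : (pnorm (pmx 1 0 (B * pnorm N)%N 1 * N)%g * pnorm N <= B * pnorm N)%N by rewrite leq_mul2r h3 orbT.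
lia.
Qed.

Lemma sgz_cases (x : int) : [\/ x < 0 /\ Num.sg x = -1, x = 0 /\ Num.sg x = 0 | 0 < x /\ Num.sg x = 1].
Proof.
case: (ltrgt0P x) => h; first by constructor 3; rewrite gtr0_sg.
  by constructor 1; rewrite ltr0_sg.
by constructor 2; rewrite h sgr0.
Qed.

(** If [x > 0], or if one of [p], [q] is below [- x] (the other then exceeds it), the signs add up
    to -1. Otherwise [p = y + u] and [q = y + v] with [y = - x] and [u], [v] nonnegative, and
    [y u + y v + u v = m] bounds all three. *)
Lemma norm_bound_of_sg (p q x m : int) : 0 <= p -> 0 <= q -> 0 < m ->
  p * q = x * x + m -> Num.sg x + Num.sg (- p - x) + Num.sg (- q - x) != -1 ->
  p <= 2 * m /\ q <= 2 * m.
Proof.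
move=> p0 q0 m0 pq.
have key (y u v : int) : 0 <= y -> 0 <= u -> 0 <= v ->
    (y + u) * (y + v) = y * y + m -> y + u <= 2 * m /\ y + v <= 2 * m.
  move=> y0 u0 v0 e; have e' : y * u + y * v + u * v = m by lia.
  case: (ltrgt0P y) y0 => // hy _; last first.
    rewrite hy !mul0r !add0r in e' *.
    have hu : 0 < u by case: (ltrgt0P u) u0 => // hu _; rewrite hu mul0r in e'; lia.
    have hv : 0 < v by case: (ltrgt0P v) v0 => // hv _; rewrite hv mulr0 in e'; lia.
    by clear e; split; nia.
  have h1 : u <= m by nia.
  have h2 : v <= m by nia.
  have uv : 1 <= u + v.
    rewrite leNgt; apply/negP => uv.
    have [eu ev] : u = 0 /\ v = 0 by lia.
    by rewrite eu ev !mulr0 in e'; lia.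
  have h3 : y <= m by clear e h1 h2; nia.
  by clear -h1 h2 h3; split; lia.
have [hx|hx] := ltrP 0 x.
  by rewrite (gtr0_sg hx) !ltr0_sg //; lia.
case: (sgz_cases (- p - x)) => -[h1 ->]; case: (sgz_cases (- q - x)) => -[h2 ->];
  case: (sgz_cases x) => -[h3 ->] // _;
  try (have := key (- x) (p + x) (q + x); rewrite ![- x + _]addrC !addrK; apply; lia).
all: exfalso; nia.
Qed.

(** This is [norm_bound_of_sg] with [p], [q] the squared lengths of the columns of [N], [x = tau N]
    and [m = n^2]. *)
Lemma finite_sg_tau n : (0 < n)%N ->
  finite_set [set N | detset n N /\
    Num.sg (tau N) + Num.sg (tau (N * pU)%g) + Num.sg (tau (N * pU * pU)%g) != -1].
Proof.
move=> n0; apply: (@finite_sub_pnorm _ (4 * (n * n))) => M [/detsetP[a [b [c [d [-> h]]]]]].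
rewrite !mul_U !tauE => hs.
pose p := a * a + c * c; pose q := b * b + d * d; pose x := a * b + c * d.
have e1 : (a + b) * - a + (c + d) * - c = - p - x by rewrite /p /x; ring.
have e2 : (a + b + - a) * - (a + b) + (c + d + - c) * - (c + d) = - q - x by rewrite /q /x; ring.
have pq : p * q = x * x + n%:Z * n%:Z by rewrite -h /p /q /x; ring.
move: hs; rewrite e1 e2 -/x => hs.
have [||| bp bq] := norm_bound_of_sg _ _ _ pq hs.
- by rewrite /p -!expr2 addr_ge0 ?sqr_ge0.
- by rewrite /q -!expr2 addr_ge0 ?sqr_ge0.
- by rewrite mulr_gt0.
have sq (u : int) : `|u|%:Z <= u * u by clear; nia.
move: (sq a) (sq b) (sq c) (sq d); rewrite pnormE; rewrite /p /q in bp bq.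
clear -bp bq; lia.
Qed.

(* [F] is the divergence of [G], for the action of [Gamma] by right translation
   ([flow_div]) and by conjugation ([flow_div_conj], with [U^-1 = U^2]). *)
Record flow_spec n (F G : pmat -> rat) : Prop := FlowSpec {
  flow_finite : finite_set [set N | detset n N /\ F N != 0];
  flow_at_infinity : finite_set [set N | detset n N /\ G N != 2^-1 - (Num.sg (tau N))%:~R / 2];
  flow_reverse : forall N, detset n N -> G N + G (N * pS)%g = 1;
  flow_edge : forall N, detset n N -> G (pS * N)%g = G N;
  flow_div : forall N, detset n N -> F N + F (N * pU)%g + F (N * pU * pU)%g =
    G (N * pU * pS)%g + G (N * pU * pU * pS)%g - G N;
  flow_div_conj : forall N, detset n N ->
    F N + F (pU * (pU * N) * pU)%g + F (pU * N * pU * pU)%g =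
    G (pS * (pU * (pU * N) * pU) * pS)%g + G (pS * (pU * N * pU * pU) * pS)%g - G N }.

(** * Splitting the coefficient function, and the flow it defines *)

Section SideFlow.
Variables (n : nat) (n_gt0 : (0 < n)%N) (F eta : pmat -> rat).
Hypothesis F_fin : finite_set [set N | detset n N /\ F N != 0].
Hypothesis eta_fin : finite_set [set N | detset n N /\ eta N != (Num.sg (tau N))%:~R / 2].
Hypothesis F_eta : forall N, detset n N ->
  F N - F (pS * N)%g = eta N - eta (pmx 1 (-1) 0 1 * N)%g.
Hypothesis F_S : forall N, detset n N ->
  F (pU * N)%g + F (pU * N * pS)%g = F N + F (N * pS)%g.
Hypothesis F_U : forall N, detset n N ->
  F (pS * N)%g + F (pS * N * pU)%g + F (pS * N * pU * pU)%g =
  F N + F (N * pU)%g + F (N * pU * pU)%g.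

Let dS N : detset n N -> detset n (pS * N)%g. Proof. exact: GammaMl GammaS. Qed.
Let dU N : detset n N -> detset n (pU * N)%g. Proof. exact: GammaMl GammaU. Qed.
Let dSr N : detset n N -> detset n (N * pS)%g. Proof. exact: GammaMr GammaS. Qed.
Let dUr N : detset n N -> detset n (N * pU)%g. Proof. exact: GammaMr GammaU. Qed.

(** It will turn out that [- theta] is the left [U]-invariant summand Omega of [F], and [F + theta]
    the left [S]-invariant summand [A]. *)
Let theta N := eta (pS * N)%g.

Let fin_pre (g g' : pmat) (P : pmat -> Prop) : Gamma g -> Gamma g' ->
  finite_set [set N | detset n N /\ P N] ->
  finite_set [set N | detset n N /\ P (g * N * g')%g].
Proof.
move=> hg hg' fP; apply: (@sub_finite_set _ _ ((fun N => g * N * g')%g @^-1` [set N | detset n N /\ P N])%classic).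
  by move=> N [hN PN]; split=> //; apply: GammaMr => //; apply: GammaMl.
apply: finite_preimage => // M N _ _ /(congr1 (fun N => (g^-1 * N * g'^-1)%g)).
have [e1 e2] := Gamma_unit hg; have [e3 e4] := Gamma_unit hg'.
by rewrite !mulgA !e1 !mul1g -!mulgA !e4 !mulg1.
Qed.

Let fin_U (P Q : pmat -> Prop) :
  finite_set [set N | detset n N /\ P N] -> finite_set [set N | detset n N /\ Q N] ->
  finite_set [set N | detset n N /\ (P N \/ Q N)].
Proof.
move=> fP fQ; apply: (@sub_finite_set _ _ ([set N | detset n N /\ P N] `|` [set N | detset n N /\ Q N])%classic).
  by move=> N [hN []]; [left|right].
by rewrite finite_setU.
Qed.

Let fin_imp (P Q : pmat -> Prop) : (forall N, detset n N -> Q N -> P N) ->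
  finite_set [set N | detset n N /\ P N] -> finite_set [set N | detset n N /\ Q N].
Proof. by move=> h; apply: sub_finite_set => N [hN /(h N hN)]. Qed.

Let theta_fin : finite_set [set N | detset n N /\ theta N != (Num.sg (tau N))%:~R / 2].
Proof.
apply: fin_imp (fin_pre GammaS Gamma1 eta_fin) => N hN.
by rewrite /theta mulg1 tau_Sl.
Qed.

Let z N := theta N - theta (pU * (pU * N))%g.

Let zE N : detset n N -> z N = F N - eta N - (F (pS * N)%g - theta N).
Proof.
move=> hN; have := F_eta hN; rewrite /z /theta.
(* [S U^2] is the inverse of [T], the matrix that occurs in [F_eta]. *)
have -> : (pS * (pU * (pU * N)))%g = (pmx 1 (-1) 0 1 * N)%g.
  by rewrite !mulgA !pmxM; congr (_ * N)%g; rewrite -pmxN; congr pmx; lia.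
lra.
Qed.

(** By [zE], [z] changes sign under [S], and it has finite support because [eta] and [theta] have
    the same behaviour at infinity. Its sums over [U]-orbits telescope, so it is a flow without
    sources. *)
Let z0 N : detset n N -> z N = 0.
Proof.
apply: flow_vanish => // {N}; first last.
- by move=> N hN; rewrite /z !UUUl; lra.
- by move=> N hN; rewrite !zE //; [rewrite /theta !SSl; lra|exact: dS].
have := fin_U (fin_U F_fin (fin_pre GammaS Gamma1 F_fin)) (fin_U eta_fin theta_fin).
apply: fin_imp => N hN; rewrite zE // mulg1.
have [->|] := eqVneq (F N) 0; last by left; left.
have [->|] := eqVneq (F (pS * N)%g) 0; last by left; right.
have [->|] := eqVneq (eta N) _; last by right; left.
have [->|] := eqVneq (theta N) _; last by right; right.
by rewrite !sub0r opprK addNr eqxx.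
Qed.

Let theta_U N : detset n N -> theta (pU * N)%g = theta N.
Proof.
move=> hN; have := z0 (dU hN); have := z0 (dU (dU hN)); rewrite /z !UUUl; lra.
Qed.

Definition side_flow N := 2^-1 - F N - eta (pS * N)%g.
Let G := side_flow.
Let A N := F N + theta N.

Let A_S N : detset n N -> A (pS * N)%g = A N.
Proof. by move=> hN; have := z0 hN; rewrite zE // /A /theta !SSl; lra. Qed.

Let GA N : G N = 2^-1 - A N. Proof. by rewrite /G /side_flow /A /theta; lra. Qed.

Lemma side_flow_fin : finite_set [set N | detset n N /\
  side_flow N != 2^-1 - (Num.sg (tau N))%:~R / 2].
Proof.
apply: fin_imp (fin_U F_fin theta_fin) => N hN; rewrite -/G GA /A.
have [->|] := eqVneq (F N) 0; last by left.
have [->|] := eqVneq (theta N) _; last by right.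
by rewrite add0r eqxx.
Qed.

(** The sum is left [S]-invariant since [A] is, left [U]-invariant by [F_S] and [theta_U], and zero
    almost everywhere because right multiplication by [S] negates [tau]. *)
Let A_NS N : detset n N -> A N + A (N * pS)%g = 0.
Proof.
apply: (@inv_const n (fun N => A N + A (N * pS)%g)) => // {N}.
- have := fin_U side_flow_fin (fin_pre Gamma1 GammaS side_flow_fin).
  apply: fin_imp => N hN; rewrite -/G !GA mul1g tau_Sr.
  have [e1|] := eqVneq (2^-1 - A N) _; last by left.
  have [e2|] := eqVneq (2^-1 - A (N * pS)%g) _; last by right.
  have -> : A N = (Num.sg (tau N))%:~R / 2 by lra.
  have -> : A (N * pS)%g = (Num.sg (- tau N))%:~R / 2 by lra.
  by rewrite sgrN rmorphN /= mulNr subrr; move/eqP.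
- by move=> N hN; rewrite -mulgA !A_S //; apply: dSr.
- move=> N hN; have := F_S hN; have := theta_U hN; have := theta_U (dSr hN).
  rewrite /A !mulgA; lra.
Qed.

(** The sum is left [U]-invariant since [theta] is, left [S]-invariant by [F_U] and [A_S], and
    almost everywhere -1/2 by [finite_sg_tau]. *)
Let theta_sum N : detset n N ->
  theta N + theta (N * pU)%g + theta (N * pU * pU)%g = - 2^-1.
Proof.
apply: (@inv_const n (fun N => theta N + theta (N * pU)%g + theta (N * pU * pU)%g)) => // {N}.
- have := fin_U theta_fin (fin_U (fin_pre Gamma1 GammaU theta_fin)
    (fin_U (fin_pre Gamma1 (GammaM GammaU GammaU) theta_fin) (finite_sg_tau n_gt0))).
  apply: fin_imp => N hN; rewrite !mul1g !mulgA.
  have [->|] := eqVneq (theta N) _; last by left.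
  have [->|] := eqVneq (theta (N * pU)%g) _; last by right; left.
  have [->|] := eqVneq (theta (N * pU * pU)%g) _; last by right; right; left.
  have [e h|] := eqVneq (Num.sg (tau N) + Num.sg (tau (N * pU)%g) +
    Num.sg (tau (N * pU * pU)%g)) (-1); last by right; right; right.
  exfalso; move/eqP: h => h; apply: h.
  rewrite -!mulrDl -!rmorphD /= e; lra.
- move=> N hN; have := A_S hN; have := A_S (dUr hN); have := A_S (dUr (dUr hN)).
  have := F_U hN; rewrite /A !mulgA; lra.
- by move=> N hN; rewrite -!mulgA !theta_U // ?mulgA; do 2?apply: dUr.
Qed.

Lemma side_flow_S N : detset n N -> side_flow N + side_flow (N * pS)%g = 1.
Proof. by move=> hN; have := A_NS hN; rewrite -/G !GA; lra. Qed.

Lemma side_flow_Sl N : detset n N -> side_flow (pS * N)%g = side_flow N.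
Proof. by move=> hN; have := A_S hN; rewrite -/G !GA => ->. Qed.

(** As [F = A - theta], [theta_sum] turns the left side into 1/2 plus three values of [A]; reversing
    the two edges on the right gives the same expression. *)
Lemma side_flow_div N : detset n N -> F N + F (N * pU)%g + F (N * pU * pU)%g =
  side_flow (N * pU * pS)%g + side_flow (N * pU * pU * pS)%g - side_flow N.
Proof.
move=> hN; have := side_flow_S (dUr hN); have := side_flow_S (dUr (dUr hN)).
by have := theta_sum hN; rewrite -/G !GA /A; lra.
Qed.

(** Left factors [U] disappear under [theta] and left factors [S] under the flow, so [theta_sum],
    which concerns right translation, also serves conjugation. *)
Lemma side_flow_div_conj N : detset n N ->
  F N + F (pU * (pU * N) * pU)%g + F (pU * N * pU * pU)%g =
  side_flow (pS * (pU * (pU * N) * pU) * pS)%g +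
  side_flow (pS * (pU * N * pU * pU) * pS)%g - side_flow N.
Proof.
move=> hN; have hX := dUr (dU (dU hN)); have hY := dUr (dUr (dU hN)).
have eX : theta (pU * (pU * N) * pU)%g = theta (N * pU)%g.
  by rewrite -!mulgA !theta_U //; do ?apply: dU; apply: dUr.
have eY : theta (pU * N * pU * pU)%g = theta (N * pU * pU)%g.
  by rewrite -!mulgA theta_U // mulgA; do 2?apply: dUr.
rewrite -!(mulgA pS) !side_flow_Sl; try exact: dSr.
have := side_flow_S hX; have := side_flow_S hY.
have := theta_sum hN; rewrite -eX -eY -/G !GA /A; lra.
Qed.

Lemma side_flowP : flow_spec n F side_flow.
Proof.
split=> //; [exact: side_flow_fin|exact: side_flow_S|exact: side_flow_Sl
  |exact: side_flow_div|exact: side_flow_div_conj].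
Qed.

(** Commuting with [S] gives [2 A N = 0] and commuting with [U] gives [3 theta N = -1/2]; hence
    [F N = - theta N = 1/6]. *)
Lemma coef_scalar N : detset n N -> (N * pS = pS * N)%g -> (N * pU = pU * N)%g -> F N = 6^-1.
Proof.
move=> hN NS NU; have := A_NS hN; rewrite NS A_S // => e1.
have := theta_sum hN; rewrite NU -mulgA NU !theta_U //; last exact: dU.
by move=> e2; rewrite /A in e1; lra.
Qed.

End SideFlow.

(** * Conditions (A) and (B) as identities between coefficients *)

Lemma mcoeff_basisMl (k k' : pmat) (x : QM) M : (k' * k = 1)%g -> (k * k' = 1)%g ->
  (basis_elt rat k * x : QM)@_M = x@_(k' * M)%g.
Proof.
move=> e1 e2; rewrite [in LHS](monalgE x) [in RHS](monalgE x).
rewrite (_ : basis_elt rat k * _ = \sum_(i <- msupp x) basis_elt rat k * (<<x@_i *g i>> : QM));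
  last exact: mulr_sumr.
have t c m : basis_elt rat k * (<<c *g m>> : QM) = <<c *g (k * m)%g>>.
  by rewrite [LHS]monoid_alg_mulUU mul1r.
rewrite (eq_bigr _ (fun m _ => t _ m)) !raddf_sum; apply: eq_bigr => m _.
rewrite /= !mcoeffU; congr (_ *+ nat_of_bool _).
by apply/eqP/eqP => [<-|->]; rewrite mulgA ?e1 ?e2 mul1g.
Qed.

Lemma mcoeff_basisMr (k k' : pmat) (x : QM) M : (k' * k = 1)%g -> (k * k' = 1)%g ->
  (x * basis_elt rat k : QM)@_M = x@_(M * k')%g.
Proof.
move=> e1 e2; rewrite [in LHS](monalgE x) [in RHS](monalgE x).
rewrite (_ : _ * basis_elt rat k = \sum_(i <- msupp x) (<<x@_i *g i>> : QM) * basis_elt rat k);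
  last exact: mulr_suml.
have t c m : (<<c *g m>> : QM) * basis_elt rat k = <<c *g (m * k)%g>>.
  by rewrite [LHS]monoid_alg_mulUU mulr1.
rewrite (eq_bigr _ (fun m _ => t _ m)) !raddf_sum; apply: eq_bigr => m _.
rewrite /= !mcoeffU; congr (_ *+ nat_of_bool _).
by apply/eqP/eqP => [<-|->]; rewrite -mulgA ?e1 ?e2 mulg1.
Qed.

Lemma mcoeff_Tinfty D M : (Tinfty D)@_M = (M \in D)%:R.
Proof.
rewrite /Tinfty raddf_sum /=; transitivity (\sum_(N <- D) (N == M)%:R : rat).
  by apply: eq_bigr => N _; rewrite mcoeffU.
have [MD|MD] := boolP (M \in D).
  rewrite (big_fsetD1 M) //= eqxx big_seq big1 ?addr0 // => N.
  by rewrite in_fsetD1 => /andP[/negPf-> _].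
by rewrite big_seq big1 // => N ND; case: eqP => // e; rewrite -e ND in MD.
Qed.

Lemma mcoeff_Sl (x : QM) M : (eltS * x)@_M = x@_(pS * M)%g.
Proof. by apply: mcoeff_basisMl; rewrite pmxM -pmx1 -pmxN; congr pmx; lia. Qed.

Lemma mcoeff_Sr (x : QM) M : (x * eltS)@_M = x@_(M * pS)%g.
Proof. by apply: mcoeff_basisMr; rewrite pmxM -pmx1 -pmxN; congr pmx; lia. Qed.

Lemma mcoeff_Tl (x : QM) M : (eltT * x)@_M = x@_(pmx 1 (-1) 0 1 * M)%g.
Proof. by apply: mcoeff_basisMl; rewrite pmxM -pmx1; congr pmx; lia. Qed.

Lemma mcoeff_Ul (x : QM) M : (eltU * x)@_M = x@_(pU * (pU * M))%g.
Proof.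
rewrite mulgA; apply: mcoeff_basisMl; rewrite !pmxM -pmx1 -pmxN; congr pmx; lia.
Qed.

Lemma mcoeff_Ur (x : QM) M : (x * eltU)@_M = x@_(M * pU * pU)%g.
Proof.
rewrite -mulgA; apply: mcoeff_basisMr; rewrite !pmxM -pmx1 -pmxN; congr pmx; lia.
Qed.

Lemma mcoeffDQ (x y : QM) M : (x + y)@_M = x@_M + y@_M.
Proof. exact: mcoeffD. Qed.

Lemma mcoeffNQ (x : QM) M : (- x)@_M = - x@_M.
Proof. exact: mcoeffN. Qed.

Lemma expand_B (R : nzRingType) (x s u y : R) :
  x * (1 + s) = (1 + u + u ^+ 2) * y -> x + x * s = y + u * y + u * (u * y).
Proof. by rewrite mulrDr !mulrDl mulr1 mul1r expr2 -mulrA. Qed.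

Lemma expand_B' (R : nzRingType) (x s u y : R) :
  x * (1 + u + u ^+ 2) = (1 + s) * y -> x + x * u + x * u * u = y + s * y.
Proof. by rewrite !mulrDr !mulrDl mulr1 mul1r expr2 mulrA. Qed.

Lemma expand_A (R : nzRingType) (x s t w y : R) :
  (1 - s) * x - w * (1 - s) = (1 - t) * y -> x - s * x - (w - w * s) = y - t * y.
Proof. by rewrite mulrBr !mulrBl mulr1 !mul1r. Qed.

Lemma mcoeff_eq23 (x1 x2 y1 y2 y3 : QM) M : x1 + x2 = y1 + y2 + y3 ->
  x1@_M + x2@_M = y1@_M + y2@_M + y3@_M.
Proof. by move=> /(congr1 (mcoeff M)); rewrite !mcoeffDQ. Qed.

Lemma mcoeff_eq32 (x1 x2 x3 y1 y2 : QM) M : x1 + x2 + x3 = y1 + y2 ->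
  x1@_M + x2@_M + x3@_M = y1@_M + y2@_M.
Proof. by move=> /(congr1 (mcoeff M)); rewrite !mcoeffDQ. Qed.

Lemma mcoeff_eqB (x1 x2 x3 x4 y1 y2 : QM) M : x1 - x2 - (x3 - x4) = y1 - y2 ->
  x1@_M - x2@_M - (x3@_M - x4@_M) = y1@_M - y2@_M.
Proof. by move=> /(congr1 (mcoeff M)); rewrite !(mcoeffDQ, mcoeffNQ). Qed.

(** The right side of the hypothesis is left [U]-invariant; comparing coefficients at [N] and [U N]
    eliminates [xi]. *)
Lemma condB_S (x xi : QM) : x * (1 + eltS) = (1 + eltU + eltU ^+ 2) * xi ->
  forall N, x@_(pU * N)%g + x@_(pU * N * pS)%g = x@_N + x@_(N * pS)%g.
Proof.
move=> /expand_B e.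
have h M : x@_M + x@_(M * pS)%g = xi@_M + xi@_(pU * (pU * M))%g + xi@_(pU * (pU * (pU * (pU * M))))%g.
  have <- := mcoeff_Sr x M; have <- := mcoeff_Ul xi M.
  have <- := mcoeff_Ul xi (pU * (pU * M))%g; have <- := mcoeff_Ul (eltU * xi) M.
  exact: mcoeff_eq23.
move=> N; have := h N; have := h (pU * N)%g; rewrite !UUUl; lra.
Qed.

(** Here left [S]-invariance of the right side eliminates [xi]. *)
Lemma condB_U (x xi : QM) : x * (1 + eltU + eltU ^+ 2) = (1 + eltS) * xi ->
  forall N, x@_(pS * N)%g + x@_(pS * N * pU)%g + x@_(pS * N * pU * pU)%g =
    x@_N + x@_(N * pU)%g + x@_(N * pU * pU)%g.
Proof.
move=> /expand_B' e.
have h M : x@_M + x@_(M * pU * pU)%g + x@_(M * pU * pU * pU * pU)%g = xi@_M + xi@_(pS * M)%g.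
  have <- := mcoeff_Sl xi M; have <- := mcoeff_Ur x M.
  have <- := mcoeff_Ur x (M * pU * pU)%g; have <- := mcoeff_Ur (x * eltU) M.
  exact: mcoeff_eq32.
move=> N; have := h N; have := h (pS * N)%g; rewrite !SSl !UUUr; lra.
Qed.

Lemma condA_coef (D : {fset pmat}) (x xi : QM) :
  (1 - eltS) * x - Tinfty D * (1 - eltS) = (1 - eltT) * xi ->
  forall N, x@_N - x@_(pS * N)%g - ((N \in D)%:R - ((N * pS)%g \in D)%:R) =
    xi@_N - xi@_(pmx 1 (-1) 0 1 * N)%g.
Proof.
move=> /expand_A e N; have <- := mcoeff_Sl x N; have <- := mcoeff_Tl xi N.
have <- := mcoeff_Tinfty D N; have <- := mcoeff_Tinfty D (N * pS)%g.
have <- := mcoeff_Sr (Tinfty D) N.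
exact: mcoeff_eqB.
Qed.

Lemma Rn_fin n (x : QM) : finite_set [set N | detset n N /\ x@_N != 0].
Proof.
apply: (@sub_finite_set _ _ [set` msupp x]); last exact: finite_fset.
by move=> N [_]; rewrite mcoeff_neq0.
Qed.

Lemma mulz_eq1 (x w : int) : x * w = 1 -> (x = 1 /\ w = 1) \/ (x = -1 /\ w = -1).
Proof.
move=> e; have : (`|x| * `|w|)%N == 1%N by rewrite -abszM e.
by rewrite muln_eq1 => /andP[/eqP hx /eqP hw]; nia.
Qed.

Lemma absz_factor_le (u v : int) m : 0 < u * v -> u * v <= m%:Z ->
  (`|u| <= m)%N /\ (`|v| <= m)%N.
Proof.
move=> h0 hm; have u0 : (0 < `|u|)%N by rewrite absz_gt0; apply: contraTneq h0 => ->; rewrite mul0r.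
have v0 : (0 < `|v|)%N by rewrite absz_gt0; apply: contraTneq h0 => ->; rewrite mulr0.
have e : (`|u| * `|v| <= m)%N by rewrite -abszM; lia.
by split; apply: leq_trans e; rewrite ?leq_pmulr ?leq_pmull.
Qed.

(** * Solving [(1 - T) chi = T_n^oo (1 - S)] with infinite support *)

Section CuspSign.
Variables (n : nat) (n_gt0 : (0 < n)%N) (D : {fset pmat}) (D_reps : infty_reps n D).

Lemma reps_uniq M g : M \in D -> Gamma g -> (g * M)%g \in D -> (g * M)%g = M.
Proof.
move=> MD hg gMD; have [[hM _]] := (D_reps.1 _ MD, D_reps.1 _ MD).
have [N [_ uN]] := D_reps.2 _ hM.
transitivity N; [symmetry|]; apply: uN; split=> //; first by exists g.
by exists 1%g; [exact: Gamma1|rewrite mul1g].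
Qed.

(** A nontrivial translation moves the upper right entry by a nonzero multiple of [d], while [D] has
    only one element in each orbit. *)
Lemma trans_reps (k : nat) M : M \in D -> (pmx 1 (- k%:Z) 0 1 * M)%g \in D -> k = 0%N.
Proof.
move=> MD kMD; have [hM fM] := D_reps.1 _ MD.
have hg : Gamma (pmx 1 (- k%:Z) 0 1) by apply/detset_pmx; lia.
have {hg kMD MD} := reps_uniq MD hg kMD.
move: hM fM => /detsetP[a [b [c [d [-> h]]]]] /fixes_infty_pm; rewrite mx2E => c0.
subst c; rewrite pmxM => /pmxP[[e1 e2 e3 e4]|[e1 e2 e3 e4]].
  have /eqP : k%:Z * d = 0 by lia.
  rewrite mulf_eq0 => /orP[/eqP k0|/eqP d0]; first by lia.
  by move: h; rewrite d0; lia.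
have a0 : a = 0 by lia.
by move: h; rewrite a0; lia.
Qed.

(* [cusp_sign] is the function chi with (1 - T) chi = T_n^oo (1 - S): it is half
   the sign of [c d], hence invariant under T, unless the geodesic from [N 0] to
   [N oo] ends at oo, where the step is placed at the representative in [D]. *)
Definition chi_inf (N : pmat) : rat :=
  if `[< exists k : nat, (pmx 1 (- k%:Z) 0 1 * N)%g \in D >] then 2^-1 else - 2^-1.

Definition cusp_sign (N : pmat) : rat :=
  let lr := entry_fun (fun a b c d => c * d) N in
  if lr != 0 then (Num.sg lr)%:~R / 2
  else if entry_fun (fun a b c d => c == 0) N then chi_inf N
  else - chi_inf (N * pS)%g.

Lemma cusp_signE a b c d : cusp_sign (pmx a b c d) =
  if c * d != 0 then (Num.sg (c * d))%:~R / 2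
  else if c == 0 then chi_inf (pmx a b c d) else - chi_inf (pmx b (- a) d (- c)).
Proof.
rewrite /cusp_sign mul_S !entry_funE // => *; first by rewrite oppr_eq0.
by rewrite mulrNN.
Qed.

(** Along an orbit of translations [chi_inf] is a step function whose jump, if any, is at the
    element of [D]. *)
Lemma chi_inf_T N : chi_inf N - chi_inf (pmx 1 (-1) 0 1 * N)%g = (N \in D)%:R.
Proof.
have step (k : nat) : (pmx 1 (- k%:Z) 0 1 * (pmx 1 (-1) 0 1 * N))%g = (pmx 1 (- k.+1%:Z) 0 1 * N)%g.
  by rewrite mulgA pmxM; congr (_ * N)%g; congr pmx; lia.
rewrite /chi_inf; case: asboolP => h1; case: asboolP => h2; case: (boolP (N \in D)) => ND.
- case: h2 => k; rewrite step => kD.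
  by have := trans_reps ND kD.
- by rewrite subrr.
- by rewrite /= ; lra.
- exfalso; case: h1 => -[|k] kD; first by rewrite pmx1 mul1g (negPf ND) in kD.
  by apply: h2; exists k; rewrite step.
- exfalso; apply: h1; exists 0%N; by rewrite pmx1 mul1g.
- exfalso; case: h2 => k; rewrite step => kD; apply: h1; by exists k.+1.
- exfalso; apply: h1; exists 0%N; by rewrite pmx1 mul1g.
- by rewrite subrr.
Qed.

Lemma notin_reps a b c d : c != 0 -> pmx a b c d \in D = false.
Proof.
move=> c0; apply/negP => /(D_reps.1 _)[_ /fixes_infty_pm]; rewrite mx2E => e.
by rewrite e eqxx in c0.
Qed.

(** Left translation keeps the lower row, so only [c = 0] and [d = 0] contribute; there [chi_inf_T]
    applies to [N] or to [N S]. *)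
Lemma cusp_sign_T N : detset n N ->
  cusp_sign N - cusp_sign (pmx 1 (-1) 0 1 * N)%g = (N \in D)%:R - ((N * pS)%g \in D)%:R.
Proof.
move=> /detsetP[a [b [c [d [-> h]]]]]; have := chi_inf_T (pmx a b c d).
have := chi_inf_T (pmx b (- a) d (- c)).
rewrite mul_S !pmxM !mul1r !mul0r !add0r !mulN1r.
have -> : - a + - - c = - (a + - c) by lia.
rewrite !cusp_signE.
have [c0|c0] := eqVneq c 0.
  have d0 : d != 0 by apply/eqP => d0; nia.
  rewrite c0 mul0r eqxx /= => _ ->.
  by rewrite (notin_reps b (- a) (- 0) d0) subr0.
have [d0|d0] := eqVneq d 0.
  rewrite d0 mulr0 eqxx /= => + _; rewrite (notin_reps a b 0 c0) => <-; rewrite mulr0n; lra.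
by rewrite mulf_eq0 (negPf c0) (negPf d0) /= !notin_reps // !subrr.
Qed.

(** The representative in [D] differs from the matrix by a translation and has bounded entries, so
    for large [b] the sign of [b] tells on which side of the step the matrix lies. *)
Lemma chi_inf_sg : exists B : nat, forall a b d : int, a * d = n%:Z -> 0 < a ->
  (B < `|b|)%N -> chi_inf (pmx a b 0 d) = (Num.sg b)%:~R / 2.
Proof.
have [B hB] := finite_pnorm_bound (finite_fset D).
exists B => a b d adn a0 bB.
have hN : detset n (pmx a b 0 d) by apply/detset_pmx; lia.
have [N' [[N'D [g hg e]] _]] := D_reps.2 _ hN.
have [j ej] : exists j, N' = pmx a (b + j * d) 0 d.
  move: hg e => /detsetP[x [y [z [w [-> h]]]]]; rewrite pmxM => e.
  have := (D_reps.1 _ N'D).2; rewrite [X in fixes_infty X]e => /fixes_infty_pm; rewrite mx2E => z0.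
  have {}z0 : z = 0 by nia.
  have xw : x * w = 1 by subst z; lia.
  have [[x1 w1]|[x1 w1]] : (x = 1 /\ w = 1) \/ (x = -1 /\ w = -1) by exact: mulz_eq1.
    by exists y; rewrite e x1 z0 w1; congr pmx; lia.
  by exists (- y); rewrite e x1 z0 w1 -[RHS]pmxN; congr pmx; lia.
have d0 : 0 < d by nia.
have := hB _ N'D; rewrite ej pnormE => bnd.
rewrite /chi_inf; case: asboolP => [[k kD]|nk].
  have [b0|b0|b0] := ltrgt0P b; last by subst b; lia.
    by rewrite gtr0_sg //; lra.
  exfalso.
  have j0 : 0 < j by nia.
  have hg' : Gamma (pmx 1 (k%:Z + j) 0 1) by apply/detset_pmx; lia.
  have e' : (pmx 1 (k%:Z + j) 0 1 * (pmx 1 (- k%:Z) 0 1 * pmx a b 0 d))%g = N'.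
    by rewrite ej !pmxM; congr pmx; lia.
  have := reps_uniq kD hg'; rewrite e' => /(_ N'D).
  by rewrite ej pmxM => /pmxP[[_ e2 _ _]|[e1 _ _ _]]; nia.
have [b0|b0|b0] := ltrgt0P b; [exfalso| |by subst b; lia].
  have j0 : j < 0 by nia.
  apply: nk; exists `|j|%N; rewrite pmxM.
  by move: N'D; rewrite ej; congr (_ \in D); congr pmx; lia.
by rewrite ltr0_sg //; lra.
Qed.

Lemma cusp_sign_fin :
  finite_set [set N | detset n N /\ cusp_sign N != (Num.sg (tau N))%:~R / 2].
Proof.
have [B hB] := chi_inf_sg.
apply: (@finite_sub_pnorm _ (4 * n + B)) => N [/detsetP[a [b [c [d [-> h]]]]]].
rewrite cusp_signE tauE pnormE => hs; rewrite leqNgt; apply: contra hs => hs; apply/eqP.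
have [c0|c0] := eqVneq c 0.
  rewrite c0 mul0r eqxx /= addr0; subst c.
  have ad : a * d = n%:Z by lia.
  have [ha hd] : (`|a| <= n)%N /\ (`|d| <= n)%N by apply: absz_factor_le; lia.
  have [a0|a0] := ltrP 0 a.
    by rewrite (hB a b d) ?sgrM ?(gtr0_sg a0) ?mul1r //; lia.
  rewrite -pmxN oppr0 (hB (- a) (- b) (- d)); [|lia|nia|lia].
  by rewrite sgrN sgrM (ltr0_sg (_ : a < 0)) ?mulN1r //; nia.
have [d0|d0] := eqVneq d 0.
  rewrite d0 mulr0 eqxx /= addr0; subst d.
  have bc : b * - c = n%:Z by lia.
  have [ha hd] : (`|b| <= n)%N /\ (`|- c| <= n)%N by apply: absz_factor_le; lia.
  rewrite abszN in hd.
  have [b0|b0] := ltrP 0 b.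
    by rewrite (hB b (- a) (- c)) ?sgrN ?sgrM ?(gtr0_sg b0) ?mulr1 ?rmorphN /=; [lra|lia|lia|lia].
  rewrite -pmxN oppr0 !opprK (hB (- b) a c); [|lia|nia|lia].
  by rewrite sgrM (ltr0_sg (_ : b < 0)) ?mulrN1 ?rmorphN /= ?mulNr //; nia.
rewrite mulf_eq0 (negPf c0) (negPf d0) /=; congr (_%:~R / 2).
(* If [a b] and [c d] have opposite signs, so do [a d] and [b c], and as their difference is [n] all
   entries are at most [n]. Otherwise [tau] has the sign of [c d]. *)
have [ab|ab] := ltrP ((a * b) * (c * d)) 0.
  exfalso.
  have h1 : (a * d) * (b * c) < 0 by move: ab; congr (_ < 0); ring.
  have [h2 h3] : 0 < a * d /\ b * c < 0 by move: h h1; move: (a * d) (b * c) => u v; nia.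
  have : [/\ `|a| <= n, `|b| <= n, `|c| <= n & `|d| <= n]%N.
    have [//||ha hd] := @absz_factor_le a d n; first by lia.
    have [||hb hc] := @absz_factor_le b (- c) n; [lia|lia|].
    by rewrite abszN in hc; split.
  case; lia.
have cd : c * d != 0 by rewrite mulf_neq0.
case: (sgz_cases (c * d)) => -[k1 ->].
- by rewrite ltr0_sg //; nia.
- by rewrite k1 eqxx in cd.
- by rewrite gtr0_sg //; nia.
Qed.

End CuspSign.

(** * The comparison flow of [x^2 + x y + y^2] on [Gamma] *)

Lemma set_bij_can (T : Type) (X : set T) (h v : T -> T) :
  (forall x, X x -> X (h x)) -> (forall x, X x -> X (v x)) ->
  (forall x, v (h x) = x) -> (forall x, h (v x) = x) -> set_bij X X h.
Proof.
move=> hX vX vh hv; split; first by move=> x; apply: hX.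
  by move=> x y _ _ /(congr1 v); rewrite !vh.
by move=> x Xx; exists (v x); [apply: vX|apply: hv].
Qed.

Lemma mul_SS N : (N * pS * pS)%g = N.
Proof.
by have [a [b [c [d ->]]]] := pmx_eta N; rewrite !mul_S -pmxN; congr pmx; lia.
Qed.

Lemma Gamma_bij_S : set_bij Gamma Gamma (fun g => (g * pS)%g).
Proof.
apply: (@set_bij_can _ _ _ (fun g => (g * pS)%g)) => [g|g|g|g]; try exact: mul_SS.
  exact: GammaMr GammaS.
exact: GammaMr GammaS.
Qed.

Lemma Gamma_bij_U : set_bij Gamma Gamma (fun g => (g * pU)%g).
Proof.
have h g : Gamma g -> Gamma (g * pU)%g by exact: GammaMr GammaU.
apply: (@set_bij_can _ _ _ (fun g => (g * pU * pU)%g)) => // [g hg||]; try exact: UUUr.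
by do 2!apply: (h).
Qed.

(* The coefficients [A0, B0, C0] of [x^2 + x y + y^2] transformed by [g]. *)
Definition A0 : pmat -> int := entry_fun (fun x y z w => x * x + x * z + z * z).
Definition B0 : pmat -> int := entry_fun (fun x y z w => 2 * (x * y) + x * w + y * z + 2 * (z * w)).
Definition C0 : pmat -> int := entry_fun (fun x y z w => y * y + y * w + w * w).

Lemma A0E x y z w : A0 (pmx x y z w) = x * x + x * z + z * z.
Proof. by apply: entry_funE => *; rewrite !mulrNN. Qed.
Lemma B0E x y z w : B0 (pmx x y z w) = 2 * (x * y) + x * w + y * z + 2 * (z * w).
Proof. by apply: entry_funE => *; rewrite !mulrNN. Qed.
Lemma C0E x y z w : C0 (pmx x y z w) = y * y + y * w + w * w.
Proof. by apply: entry_funE => *; rewrite !mulrNN. Qed.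

Lemma disc0 g : Gamma g -> 4 * (A0 g * C0 g) = B0 g * B0 g + 3.
Proof.
move=> /detsetP[x [y [z [w [-> h]]]]]; rewrite A0E B0E C0E.
transitivity ((2 * (x * y) + x * w + y * z + 2 * (z * w)) *
  (2 * (x * y) + x * w + y * z + 2 * (z * w)) + 3 * ((x * w - y * z) * (x * w - y * z))).
  by ring.
by rewrite h.
Qed.

Lemma form0_ge (u v : int) : (`|u| + `|v| <= `|(2 * (u * u + u * v + v * v))%R|)%N.
Proof.
have h1 : `|u|%:Z <= u * u by nia.
have h2 : `|v|%:Z <= v * v by nia.
have : 0 <= (u + v) * (u + v) by rewrite -expr2 sqr_ge0.
have -> : (u + v) * (u + v) = u * u + 2 * (u * v) + v * v by ring.
lia.
Qed.

Lemma A0_ge0 g : 0 <= A0 g.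
Proof.
have [x [y [z [w ->]]]] := pmx_eta g; rewrite A0E.
have : 0 <= (x + z) * (x + z) + x * x + z * z by rewrite -!expr2 !addr_ge0 ?sqr_ge0.
have -> : (x + z) * (x + z) + x * x + z * z = 2 * (x * x + x * z + z * z) by ring.
lia.
Qed.

Lemma C0_ge0 g : 0 <= C0 g.
Proof.
have [x [y [z [w ->]]]] := pmx_eta g; rewrite C0E.
have : 0 <= (y + w) * (y + w) + y * y + w * w by rewrite -!expr2 !addr_ge0 ?sqr_ge0.
have -> : (y + w) * (y + w) + y * y + w * w = 2 * (y * y + y * w + w * w) by ring.
lia.
Qed.

Lemma pnorm_le_form0 g : (pnorm g)%:Z <= 2 * (A0 g + C0 g).
Proof.
have hA := A0_ge0 g; have hC := C0_ge0 g; move: hA hC.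
have [x [y [z [w ->]]]] := pmx_eta g; rewrite A0E C0E pnormE.
have := form0_ge x z; have := form0_ge y w; lia.
Qed.

(** [B0 g] is odd, since [x w + y z = 1 + 2 y z]. This gives every edge a direction, which the form
    [x^2 + y^2] would not do. *)
Lemma B0_neq0 g : Gamma g -> B0 g != 0.
Proof.
move=> /detsetP[x [y [z [w [-> h]]]]]; rewrite B0E; apply/eqP.
have -> : x * w = 1 + y * z by lia.
lia.
Qed.

Lemma B0_S g : B0 (g * pS)%g = - B0 g.
Proof. by have [x [y [z [w ->]]]] := pmx_eta g; rewrite mul_S !B0E; ring. Qed.

Lemma B0_US g : B0 (g * pU * pS)%g = B0 g + 2 * A0 g.
Proof. by have [x [y [z [w ->]]]] := pmx_eta g; rewrite mul_U mul_S !B0E A0E; ring. Qed.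

Lemma B0_UUS g : B0 (g * pU * pU * pS)%g = B0 g + 2 * C0 g.
Proof. by have [x [y [z [w ->]]]] := pmx_eta g; rewrite !mul_U mul_S !B0E C0E; ring. Qed.

Definition flow0 g : rat := (B0 g < 0)%R%:R.

Lemma flow0_S g : Gamma g -> flow0 g + flow0 (g * pS)%g = 1.
Proof.
move=> /B0_neq0; rewrite /flow0 B0_S oppr_lt0.
by case: ltrgt0P => //=; rewrite ?add0r ?addr0.
Qed.

Lemma flow0E g : Gamma g -> flow0 g = 2^-1 - (Num.sg (B0 g))%:~R / 2.
Proof.
move=> /B0_neq0; rewrite /flow0; case: (sgz_cases (B0 g)) => -[h ->].
- by rewrite h => _; rewrite /=; lra.
- by rewrite h eqxx.
- by rewrite ltNge ltW //= => _; lra.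
Qed.

(** For [B < 0], both [B + 2 A] and [B + 2 C] negative would give [B^2 > 4 A C], against the
    discriminant -3. If exactly one is negative the flow is conserved; if none is, the discriminant
    forces [A = C = 1] and [B = -1]. *)
Lemma flow0_div g : Gamma g ->
  flow0 (g * pU * pS)%g + flow0 (g * pU * pU * pS)%g - flow0 g =
  - [&& A0 g == 1, B0 g == -1 & C0 g == 1]%R%:R.
Proof.
move=> hg; rewrite /flow0 B0_US B0_UUS.
have hd := disc0 hg; have := B0_neq0 hg; have := A0_ge0 g; have := C0_ge0 g.
move: (A0 g) (B0 g) (C0 g) hd => A B C hd C_ge A_ge Bn.
have A_gt : 0 < A by rewrite lt_neqAle A_ge andbT; apply/eqP => e; subst A; nia.
have C_gt : 0 < C by rewrite lt_neqAle C_ge andbT; apply/eqP => e; subst C; nia.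
have [B_ge|B_lt] := leP 0 B.
  have -> : (B + 2 * A < 0) = false by lia.
  have -> : (B + 2 * C < 0) = false by lia.
  have -> : (B == -1) = false by lia.
  by rewrite andbF /=; lra.
have [hA|hA] := ltP (B + 2 * A) 0; have [hC|hC] := ltP (B + 2 * C) 0.
- by exfalso; nia.
- have -> : (A == 1) && ((B == -1) && (C == 1)) = false by apply/negP; lia.
  by rewrite /=; lra.
- have -> : (A == 1) && ((B == -1) && (C == 1)) = false by apply/negP; lia.
  by rewrite /=; lra.
- have [-> [-> ->]] : A = 1 /\ (B = -1 /\ C = 1).
    have AC : A = C.
      apply/eqP; rewrite eq_le; apply/andP; split; rewrite leNgt; apply/negP => h; nia.
    rewrite -AC in hd hC *; 
    have nB : B + 2 * A != 0 by apply/eqP => e; have eB : B = - (2 * A); [lia|subst B; lia].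
    have A1 : A <= 1 by have : 0 < B + 2 * A; [lia|clear -hd B_lt; nia].
    have {}A1 : A = 1 by lia.
    by rewrite A1 in hd; split=> //; split=> //; have [] := @mulz_eq1 B B _; lia.
  by rewrite !eqxx /=; lra.
Qed.

(** A single right [U]-orbit: the three edges at one vertex of the tree. *)
Definition wells : seq pmat := [:: pmx 1 (-1) 0 1; pmx 0 (-1) 1 0; pmx 1 0 (-1) 1].

Lemma wellsP g : Gamma g -> [&& A0 g == 1, B0 g == -1 & C0 g == 1] = (g \in wells).
Proof.
move=> hg; apply/idP/idP => [|]; last first.
  by rewrite !inE => /or3P[] /eqP->; rewrite A0E B0E C0E.
move: hg => /detsetP[x [y [z [w [-> h]]]]]; rewrite A0E B0E C0E => /and3P[/eqP e1 /eqP e2 /eqP e3].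
have [||] : [\/ x = 0 /\ (z = 1 \/ z = -1), z = 0 /\ (x = 1 \/ x = -1) | (x = 1 /\ z = -1) \/ (x = -1 /\ z = 1)].
- move=> {h e2 e3}.
  have hx : -1 <= x <= 1 by nia.
  have hz : -1 <= z <= 1 by nia.
  have i3 (v : int) : -1 <= v <= 1 -> [\/ v = -1, v = 0 | v = 1].
    move=> hv; have [->|[->|->]] : v = -1 \/ v = 0 \/ v = 1 by lia.
    - by constructor 1.
    - by constructor 2.
    - by constructor 3.
  move: e1; case: (i3 _ hx) => ->; case: (i3 _ hz) => -> //= _;
    by [constructor 1; lia|constructor 2; lia|constructor 3; lia].
- move=> [x0 hz]; rewrite !inE; apply/or3P; constructor 2; apply/eqP.
  by subst x; case: hz => hz; subst z; [|rewrite -pmxN]; congr pmx; lia.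
- move=> [z0 hx]; rewrite !inE; apply/or3P; constructor 1; apply/eqP.
  by subst z; case: hx => hx; subst x; [|rewrite -pmxN]; congr pmx; lia.
- move=> hxz; rewrite !inE; apply/or3P; constructor 3; apply/eqP.
  by case: hxz => -[ex ez]; subst x z; [|rewrite -pmxN]; congr pmx; lia.
Qed.

Lemma fsum_flow0 : \sum_(g \in Gamma)
  (flow0 (g * pU * pS)%g + flow0 (g * pU * pU * pS)%g - flow0 g) = - 3.
Proof.
have wG : ([set` wells] `<=` Gamma)%classic.
  by move=> g /=; rewrite !inE => /or3P[] /eqP->; apply/detset_pmx.
rewrite (fsumW wG); last first.
  by move=> g hg; rewrite flow0_div // wellsP //; have [//|_] := boolP (g \in wells); rewrite mulr0n oppr0 eqxx.
rewrite -fsbig_seq; last first.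
  rewrite /= !inE !negb_or andbT -andbA; apply/and3P; split;
    by apply/eqP => /pmxP[[]|[]] *; lia.
rewrite big_seq (eq_bigr (fun=> -1)); last first.
  move=> g hg; have Gg := wG _ hg; by rewrite flow0_div // wellsP // hg.
by rewrite -big_seq /wells !big_cons big_nil /=; lra.
Qed.

(** Vertices are counted once for each of their three edges, so the total -3 of the comparison flow
    means -1 for [f]. *)
Lemma Gamma_fsum (f G : pmat -> rat) :
  (forall g, Gamma g -> f g + f (g * pU)%g + f (g * pU * pU)%g =
     G (g * pU * pS)%g + G (g * pU * pU * pS)%g - G g) ->
  (forall g, Gamma g -> G g + G (g * pS)%g = 1) ->
  fin_supp Gamma f -> finite_set [set g | Gamma g /\ G g != flow0 g] ->
  \sum_(g \in Gamma) f g = -1.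
Proof.
move=> fG GS ff fd.
have := fsum_flow Gamma_bij_S Gamma_bij_U fG GS flow0_S ff fd.
rewrite fsum_flow0; lra.
Qed.

(** * Sums over right cosets *)

Lemma pmat_mulI n M : (0 < n)%N -> detset n M -> injective (fun g => M * g)%g.
Proof.
move=> n0 /detsetP[a [b [c [d [-> h]]]]] g g' /(congr1 (fun N => pmx d (- b) (- c) a * N)%g).
rewrite !mulgA !pmxM.
have [x [y [z [w ->]]]] := pmx_eta g; have [x' [y' [z' [w' ->]]]] := pmx_eta g'.
have -> : pmx (d * a + - b * c) (d * b + - b * d) (- c * a + a * c) (- c * b + a * d)
  = pmx n%:Z 0 0 n%:Z by congr pmx; lia.
rewrite !pmxM !mul0r !addr0 !add0r => e; apply/pmxP.
have nz : n%:Z != 0 by lia.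
case/pmxP: e => -[]; [do 4!move/(mulfI nz)->; by left|].
by rewrite -!mulrN; do 4!move/(mulfI nz)->; right.
Qed.

Lemma sg_neq_le (u v : int) : v != 0 -> Num.sg u != Num.sg v -> u * v <= 0.
Proof.
move=> v0; case: (sgz_cases u) => -[hu ->]; case: (sgz_cases v) => -[hv ->] //= _; nia.
Qed.

Lemma sqr_sum_ge1 (u v : int) : (u != 0) || (v != 0) -> 1 <= u * u + v * v.
Proof.
have hu : 0 <= u * u by rewrite -expr2 sqr_ge0.
have hv : 0 <= v * v by rewrite -expr2 sqr_ge0.
by case/orP => h; [have : u * u != 0|have : v * v != 0]; rewrite ?mulf_neq0 //; lia.
Qed.

(** [tau (M0 * g)] is half the middle coefficient of the squared length of [M0 v], as a form in [v],
    transformed by [g]. For two positive definite forms the signs of the middle coefficients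
    disagree only finitely often. *)
Lemma fin_sg_coset n M0 : (0 < n)%N -> detset n M0 ->
  finite_set [set g | Gamma g /\ Num.sg (tau (M0 * g)%g) != Num.sg (B0 g)].
Proof.
move=> n0 /detsetP[a [b [c [d [-> h]]]]].
pose K := (a * a + c * c) + (b * b + d * d) - (a * b + c * d).
apply: (@finite_sub_pnorm _ `|(2 * K)%R|%N) => g [hg /sg_neq_le hs].
have {}hs := hs (B0_neq0 hg).
have := pnorm_le_form0 g; have := A0_ge0 g; have := C0_ge0 g.
move: hg hs => /detsetP[x [y [z [w [-> hg]]]]].
rewrite pmxM tauE A0E B0E C0E => hs hC hA hp.
pose u := a * x + b * z; pose v := c * x + d * z; pose u' := a * y + b * w; pose v' := c * y + d * w.
(* [A1 C2 + C1 A2 - B1 B2 / 2] is an invariant of a pair of binary forms; if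
   [B1 B2 <= 0] it bounds the definite forms involved. *)
have e : (u * u + v * v) * (y * y + y * w + w * w) + (u' * u' + v' * v') * (x * x + x * z + z * z)
  - (u * u' + v * v') * (2 * (x * y) + x * w + y * z + 2 * (z * w)) = K.
  transitivity (K * ((x * w - y * z) * (x * w - y * z))).
    by rewrite /K /u /v /u' /v'; ring.
  by rewrite hg !mulr1.
have dt : u * v' - v * u' = n%:Z.
  by transitivity ((a * d - b * c) * (x * w - y * z)); [rewrite /u /v /u' /v'; ring|rewrite h hg mulr1].
have p1 : 1 <= u * u + v * v.
  by apply: sqr_sum_ge1; apply: contraT; rewrite negb_or !negbK => /andP[/eqP e1 /eqP e2]; move: dt; rewrite e1 e2; lia.
have q1 : 1 <= u' * u' + v' * v'.
  by apply: sqr_sum_ge1; apply: contraT; rewrite negb_or !negbK => /andP[/eqP e1 /eqP e2]; move: dt; rewrite e1 e2; lia.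
move: hs; rewrite -/u -/v -/u' -/v' => hs.
have bound : (y * y + y * w + w * w) + (x * x + x * z + z * z) <= K.
  rewrite -e; move: p1 q1 hs hC hA; clear.
  move: (u * u + v * v) (u' * u' + v' * v') (y * y + y * w + w * w) (x * x + x * z + z * z) => p q C A.
  move: (_ * (_ + _)) => m p1 q1 hm C1 A1; nia.
lia.
Qed.

Section CosetSum.
Variables (n : nat) (n_gt0 : (0 < n)%N) (F G : pmat -> rat).
Hypothesis FG : flow_spec n F G.
Let F_fin := flow_finite FG.
Let G_fin := flow_at_infinity FG.
Let G_S := flow_reverse FG.
Let G_div := flow_div FG.

Lemma coset_sum M0 : detset n M0 -> \sum_(N \in right_coset M0) F N = -1.
Proof.
move=> hM; have inj := pmat_mulI n_gt0 hM.
have dM g : Gamma g -> detset n (M0 * g)%g by move=> hg; apply: GammaMr.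
have fin (P : pmat -> Prop) : finite_set [set N | detset n N /\ P N] ->
    finite_set [set g | Gamma g /\ P (M0 * g)%g].
  move=> fP; apply: (@sub_finite_set _ _ ((fun g => M0 * g)%g @^-1` [set N | detset n N /\ P N])%classic).
    by move=> g [hg Pg]; split=> //; exact: dM.
  by apply: finite_preimage => // x y _ _; exact: inj.
rewrite (reindex_fsbig (fun g => M0 * g)%g Gamma); last first.
  by split; [move=> g hg; exists g|move=> x y _ _; exact: inj|move=> N [g hg <-]; exists g].
apply: (@Gamma_fsum _ (fun g => G (M0 * g)%g)).
- by move=> g hg; rewrite !mulgA G_div //; exact: dM.
- by move=> g hg; rewrite mulgA G_S //; exact: dM.
- exact: (fin (fun N => F N != 0)).
have := fin_sg_coset n_gt0 hM; have := fin (fun N => G N != 2^-1 - (Num.sg (tau N))%:~R / 2) G_fin => f1 f2.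
apply: (@sub_finite_set _ _ ([set g | Gamma g /\ G (M0 * g)%g != 2^-1 - (Num.sg (tau (M0 * g)%g))%:~R / 2] `|`
  [set g | Gamma g /\ Num.sg (tau (M0 * g)%g) != Num.sg (B0 g)])%classic); last by rewrite finite_setU.
move=> g [hg]; rewrite flow0E //.
have [->|] := eqVneq (G (M0 * g)%g) (2^-1 - (Num.sg (tau (M0 * g)%g))%:~R / 2); last by left.
have [->|] := eqVneq (Num.sg (tau (M0 * g)%g)) (Num.sg (B0 g)); last by right.
by rewrite eqxx.
Qed.

End CosetSum.

(** * Conjugation and elliptic classes *)

Lemma conj_pmx a b c d x y z w : x * w - y * z = 1 ->
  (pmx a b c d ^ pmx x y z w)%g =
  pmx (w * (a * x + b * z) - y * (c * x + d * z)) (w * (a * y + b * w) - y * (c * y + d * w))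
      (x * (c * x + d * z) - z * (a * x + b * z)) (x * (c * y + d * w) - z * (a * y + b * w)).
Proof. by move=> h; rewrite /conjg (pmxV h) !pmxM; congr pmx; lia. Qed.

Lemma conj_det n M g : Gamma g -> detset n M -> detset n (M ^ g)%g.
Proof. by move=> hg hM; apply: GammaMl; [exact: GammaV|exact: GammaMr]. Qed.

Lemma conj_mul M g h : Gamma g -> Gamma h -> (M ^ (g * h) = (M ^ g) ^ h)%g.
Proof.
move=> /detsetP[x [y [z [w [-> hg]]]]] /detsetP[x' [y' [z' [w' [-> hh]]]]].
have e : (x * x' + y * z') * (z * y' + w * w') - (x * y' + y * w') * (z * x' + w * z') = 1.
  by transitivity ((x * w - y * z) * (x' * w' - y' * z')); [ring|rewrite hg hh].
rewrite /conjg (_ : (_ * _)^-1 = (pmx x' y' z' w')^-1 * (pmx x y z w)^-1)%g ?mulgA //.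
by rewrite pmxM (pmxV e) (pmxV hg) (pmxV hh) pmxM; congr pmx; lia.
Qed.

Lemma conj_S M : (M ^ pS = pS * M * pS)%g.
Proof.
rewrite /conjg (@pmxV 0 (-1) 1 0) // mulgA; congr (_ * _ * _)%g.
by rewrite -pmxN; congr pmx; lia.
Qed.

Lemma conj_U M : (M ^ pU = pU * (pU * M) * pU)%g.
Proof.
rewrite /conjg (@pmxV 1 (-1) 1 0) // !mulgA pmxM; congr (_ * _ * _)%g.
by rewrite -pmxN; congr pmx; lia.
Qed.

Lemma conj_1 (M : pmat) : (M ^ (1 : pmat) = M)%g.
Proof. by rewrite /conjg -pmx1 (@pmxV 1 0 0 1) // oppr0 pmx1 mul1g mulg1. Qed.

Lemma trsq_pmx a b c d : trsq (pmx a b c d) = (a + d) ^+ 2.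
Proof. by rewrite /pmx trsq_pm tr_mx2. Qed.

Lemma trsq_conj M g : Gamma g -> trsq (M ^ g)%g = trsq M.
Proof.
have [a [b [c [d ->]]]] := pmx_eta M => /detsetP[x [y [z [w [-> h]]]]].
rewrite (conj_pmx _ _ _ _ h) !trsq_pmx; congr (_ ^+ 2).
by transitivity ((a + d) * (x * w - y * z)); [ring|rewrite h mulr1].
Qed.

(** Up to sign, the off-diagonal entries of [M ^ g] are the values of the definite fixed-point form
    of [M] at the columns of [g]. Completing the square bounds the columns by these values, as
    [D = 4 n - tr^2] is at least 1. *)
Lemma finite_conj_elliptic n M (P : pmat -> Prop) : detset n M -> trsq M < (4 * n)%:Z ->
  finite_set [set N | detset n N /\ P N] -> finite_set [set g | Gamma g /\ P (M ^ g)%g].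
Proof.
move=> hM tM /finite_pnorm_bound[B hB].
apply: (@finite_sub_pnorm _ (16 * (pnorm M * B))) => g [hg Pg].
have := hB _ (conj (conj_det hg hM) Pg).
move: hM tM hg {Pg} => /detsetP[a [b [c [d [-> h]]]]] + /detsetP[x [y [z [w [-> hg]]]]].
rewrite (conj_pmx _ _ _ _ hg) trsq_pmx => tM.
set a' := w * _ - _; set b' := w * _ - _; set c' := x * _ - _; set d' := x * _ - _.
rewrite !pnormE => bnd.
pose D := 4 * n%:Z - (a + d) ^+ 2.
have D1 : 1 <= D by rewrite /D; lia.
have key (u v r s : int) : 4 * (r * s) = u * u + D * (v * v) ->
    (`|r| <= `|a| + `|b| + `|c| + `|d|)%N -> (`|s| <= B)%N ->
    (`|v| <= 4 * ((`|a| + `|b| + `|c| + `|d|) * B))%N.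
  move=> e1 hr hs.
  have h1 : (`|(r * s)%R| <= (`|a| + `|b| + `|c| + `|d|) * B)%N by rewrite abszM leq_mul.
  have h2 : `|v|%:Z <= v * v by clear; nia.
  have h3 : 0 <= u * u by rewrite -expr2 sqr_ge0.
  have h4 : v * v <= D * (v * v) by rewrite -[leLHS]mul1r ler_wpM2r // -expr2 sqr_ge0.
  by move: (r * s) (v * v) (u * u) (D * (v * v)) (_ * B)%N e1 h1 h2 h3 h4; clear; lia.
have [hb hc] : (`|- b'| <= B)%N /\ (`|c'| <= B)%N.
  by move: bnd; rewrite abszN; move: a' b' c' d'; clear; lia.
have [hb1 hc1] : (`|- b| <= `|a| + `|b| + `|c| + `|d|)%N /\ (`|c| <= `|a| + `|b| + `|c| + `|d|)%N.
  by rewrite abszN; clear; lia.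
have hz := @key (2 * c * x + (d - a) * z) z c c' _ hc1 hc.
have hx := @key (2 * b * z - (d - a) * x) x (- b) c' _ hb1 hc.
have hw := @key (2 * c * y + (d - a) * w) w c (- b') _ hc1 hb.
have hy := @key (2 * b * w - (d - a) * y) y (- b) (- b') _ hb1 hb.
have {}hz := hz ltac:(rewrite /c' /D -h; ring).
have {}hx := hx ltac:(rewrite /c' /D -h; ring).
have {}hw := hw ltac:(rewrite /b' /D -h; ring).
have {}hy := hy ltac:(rewrite /b' /D -h; ring).
by move: (_ * B)%N hx hy hz hw; clear; lia.
Qed.

Lemma mulr_lt0_cases (u v : int) : u * v < 0 -> (u < 0 /\ 0 < v) \/ (0 < u /\ v < 0).
Proof.
case: (ltrgt0P u) => [u0|u0|->]; last by rewrite mul0r.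
  by rewrite pmulr_rlt0 //; right.
by rewrite nmulr_rlt0 //; left.
Qed.

Lemma le_scale (u v : int) : 0 <= v -> 0 < u -> v <= u * v.
Proof. by move=> v0 u0; rewrite -[leLHS]mul1r ler_wpM2r. Qed.

(** [4 b c = tr^2 - 4 m - (a - d)^2]. *)
Lemma elliptic_bc (a b c d m : int) : a * d - b * c = m -> (a + d) ^+ 2 < 4 * m -> b * c < 0.
Proof.
move=> h t; have : 0 <= (a - d) ^+ 2 by exact: sqr_ge0.
have e : (a + d) ^+ 2 = (a - d) ^+ 2 + 4 * (a * d) by ring.
by lia.
Qed.

(** [c (d - a)] has the sign of the middle coefficient of the fixed-point form once that form is
    made positive definite. As [b c < 0], for [a d < 0] it has the same sign as [a b] and [c d]; for
    [a d >= 0] the determinant and the trace bound the entries. *)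
Lemma finite_elliptic_sg n :
  finite_set [set N | detset n N /\ (trsq N < (4 * n)%:Z /\
    Num.sg (tau N) != entry_fun (fun a b c d => Num.sg (c * (d - a))) N)].
Proof.
have E : forall a b c d, entry_fun (fun a b c d => Num.sg (c * (d - a))) (pmx a b c d) = Num.sg (c * (d - a)).
  by apply: entry_funE => a b c d; rewrite -opprD mulrNN.
apply: (@finite_sub_pnorm _ (8 * n)) => N [/detsetP[a [b [c [d [-> h]]]]]].
rewrite trsq_pmx E tauE => -[tN hs].
have bc := elliptic_bc h (_ : _ < 4 * n%:Z); rewrite -PoszM in bc; have {}bc := bc tN.
have [ad|ad] := ltrP (a * d) 0.
  exfalso; move/negP: hs; apply; apply/eqP.
  have [[a0 d0]|[a0 d0]] : (a < 0 /\ 0 < d) \/ (0 < a /\ d < 0) by exact: mulr_lt0_cases.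
    have [[b0 c0]|[b0 c0]] : (b < 0 /\ 0 < c) \/ (0 < b /\ c < 0) by exact: mulr_lt0_cases.
      by rewrite !gtr0_sg //; clear -a0 d0 b0 c0; nia.
    by rewrite !ltr0_sg //; clear -a0 d0 b0 c0; nia.
  have [[b0 c0]|[b0 c0]] : (b < 0 /\ 0 < c) \/ (0 < b /\ c < 0) by exact: mulr_lt0_cases.
    by rewrite !ltr0_sg //; clear -a0 d0 b0 c0; nia.
  by rewrite !gtr0_sg //; clear -a0 d0 b0 c0; nia.
have [hb hc] : (`|b| <= n)%N /\ (`|- c| <= n)%N by apply: absz_factor_le; lia.
rewrite abszN in hc.
have t2 : (`|(a + d)%R| <= 2 * n)%N.
  rewrite leqNgt; apply/negP => ht; move: tN; apply/negP; rewrite -leNgt.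
  rewrite expr2; move: (a + d) ht; clear => s hs.
  have : s * s = `|s|%:Z * `|s|%:Z by lia.
  by move=> ->; move: `|s|%N hs => k hk; nia.
have : (`|a| <= 2 * n)%N /\ (`|d| <= 2 * n)%N by nia.
rewrite pnormE; lia.
Qed.

(** [J] is the joint invariant of the fixed-point form and [x^2 + x y + y^2], evaluated at [g = 1].
    When the middle coefficients disagree in sign, no cancellation occurs in it, and it bounds
    [A + C]. *)
Lemma finite_elliptic_compare n M : detset n M -> trsq M < (4 * n)%:Z ->
  finite_set [set g | Gamma g /\
    entry_fun (fun a b c d => Num.sg (c * (d - a))) (M ^ g)%g != Num.sg (B0 g)].
Proof.
have E : forall a b c d, entry_fun (fun a b c d => Num.sg (c * (d - a))) (pmx a b c d) = Num.sg (c * (d - a)).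
  by apply: entry_funE => a b c d; rewrite -opprD mulrNN.
move=> /detsetP[a [b [c [d [-> h]]]]]; rewrite trsq_pmx => tM.
pose J := 2 * (c - b) - (d - a).
apply: (@finite_sub_pnorm _ `|(2 * J)%R|%N) => g [hg].
have := pnorm_le_form0 g; have := A0_ge0 g; have := C0_ge0 g; have := B0_neq0 hg.
move: hg => /detsetP[x [y [z [w [-> hg]]]]].
rewrite (conj_pmx _ _ _ _ hg) E.
pose a' := w * (a * x + b * z) - y * (c * x + d * z).
pose b' := w * (a * y + b * w) - y * (c * y + d * w).
pose c' := x * (c * x + d * z) - z * (a * x + b * z).
pose d' := x * (c * y + d * w) - z * (a * y + b * w).
rewrite -/a' -/c' -/d'.
have h' : a' * d' - b' * c' = n%:Z.
  transitivity ((a * d - b * c) * ((x * w - y * z) * (x * w - y * z))); last by rewrite h hg !mulr1.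
  by rewrite /a' /b' /c' /d'; ring.
have t' : (a' + d') ^+ 2 < 4 * n%:Z.
  have -> : a' + d' = (a + d) * (x * w - y * z) by rewrite /a' /d'; ring.
  by rewrite hg mulr1 -PoszM.
have bc := elliptic_bc h' t'.
rewrite A0E B0E C0E.
set A := x * x + _ + _; set C := y * y + _ + _; set B := 2 * _ + _ + _ + _.
have eJ : 2 * (c' * C + - b' * A) - (d' - a') * B = J.
  transitivity (J * ((x * w - y * z) * (x * w - y * z))); last by rewrite hg !mulr1.
  by rewrite /a' /b' /c' /d' /A /B /C /J; ring.
move=> Bn hC hA hp /(sg_neq_le Bn) hs.
suff : A + C <= `|J| by move: hp; clear; lia.
clear -eJ hs bc hC hA.
move: (d' - a') hs eJ => m; clear a' d'.
move=> hs eJ; have : (c' < 0 /\ 0 < b') \/ (0 < c' /\ b' < 0) by apply: mulr_lt0_cases; rewrite mulrC.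
case=> -[c0 b0].
- have hm : 0 <= m * B by rewrite -mulrA nmulr_rle0 in hs.
  have h1 := @le_scale (- c') C hC ltac:(lia); have h2 := @le_scale b' A hA b0.
  by rewrite mulNr in h1; rewrite mulNr in eJ; lia.
- have hm : m * B <= 0 by rewrite -mulrA pmulr_rle0 in hs.
  have h1 := @le_scale c' C hC c0; have h2 := @le_scale (- b') A hA ltac:(lia).
  lia.
Qed.

Section EllipticSum.
Variables (n : nat) (F G : pmat -> rat).
Hypothesis FG : flow_spec n F G.
Let F_fin := flow_finite FG.
Let G_fin := flow_at_infinity FG.
Let G_S := flow_reverse FG.
Let G_Sl := flow_edge FG.
Let G_div_conj := flow_div_conj FG.

Lemma elliptic_Gamma_sum M : detset n M -> trsq M < (4 * n)%:Z ->
  \sum_(g \in Gamma) F (M ^ g)%g = -1.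
Proof.
move=> hM tM; have dM g : Gamma g -> detset n (M ^ g)%g by move=> hg; apply: conj_det.
have GU := GammaU; have GSS := GammaS.
have dU g : Gamma g -> Gamma (g * pU)%g by move=> hg; apply: GammaM.
apply: (@Gamma_fsum _ (fun g => G (M ^ g)%g)).
- move=> g hg; rewrite !conj_mul //; do ?[exact: dU|exact: dU (dU _ _)].
  rewrite !conj_S conj_U (conj_U (pU * _ * _)%g).
  have -> : (pU * (pU * (pU * (pU * M ^ g) * pU)) * pU = pU * M ^ g * pU * pU)%g.
    by rewrite -!mulgA UUUl.
  exact: G_div_conj (dM _ hg).
- move=> g hg; rewrite conj_mul // conj_S -mulgA G_Sl; last by apply: GammaMr => //; exact: dM.
  exact: G_S (dM _ hg).
- exact: (finite_conj_elliptic (P := fun N => F N != 0) hM tM F_fin).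
(* Outside three finite sets, the flow at [M ^ g] is decided by the sign of [tau], which equals that
   of [c (d - a)] and then that of [B0 g]. *)
have f1 := finite_conj_elliptic hM tM G_fin.
have f2 := finite_conj_elliptic hM tM (finite_elliptic_sg n).
have f3 := finite_elliptic_compare hM tM.
move: f1 f2 f3; set E1 := (X in finite_set X -> _); set E2 := (X in _ -> finite_set X -> _).
set E3 := (X in _ -> _ -> finite_set X -> _) => f1 f2 f3.
apply: (@sub_finite_set _ _ (E1 `|` (E2 `|` E3))%classic); last by rewrite !finite_setU.
move=> g [hg]; rewrite flow0E // => hne.
have [e1|] := eqVneq (G (M ^ g)%g) (2^-1 - (Num.sg (tau (M ^ g)%g))%:~R / 2); last by left.
rewrite e1 in hne.
have [e2|] := eqVneq (Num.sg (tau (M ^ g)%g)) (entry_fun (fun a b c d => Num.sg (c * (d - a))) (M ^ g)%g).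
  right; right; split=> //; rewrite -e2; apply: contra hne => /eqP->; exact: eqxx.
by move=> h; right; left; split=> //; split=> //; rewrite trsq_conj.
Qed.

Lemma centralizer_conj M g : Gamma g -> (M ^ g)%g = M <-> (g * M)%g = (M * g)%g.
Proof.
move=> hg; have [e1 e2] := Gamma_unit hg; rewrite /conjg; split=> [e|<-].
  by rewrite -[RHS]mul1g -e2 -mulgA e.
by rewrite mulgA e1 mul1g.
Qed.

(** Each fibre of [g -> M ^ g] is a right translate of the centralizer, so the sum over [Gamma],
    equal to -1, counts every element of the class as often as the centralizer has elements. *)
Lemma elliptic_class_sum M : detset n M -> trsq M < (4 * n)%:Z ->
  \sum_(N \in conj_class M) F N = - (#|` fset_set (centralizer M)|%:R)^-1.
Proof.
move=> hM tM; have dM g : Gamma g -> detset n (M ^ g)%g by move=> hg; apply: conj_det.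
have fW : finite_set [set g | Gamma g /\ F (M ^ g)%g != 0].
  exact: (finite_conj_elliptic (P := fun N => F N != 0) hM tM F_fin).
have fC : finite_set (centralizer M).
  apply: sub_finite_set (finite_conj_elliptic (P := fun N => N = M) hM tM _).
    by move=> g [hg cg]; split=> //; apply/centralizer_conj.
  by apply: (@sub_finite_set _ _ [set M]); [move=> N []|exact: finite_set1].
pose W := fset_set [set g | Gamma g /\ F (M ^ g)%g != 0].
pose C := fset_set (centralizer M).
have inW g : g \in W -> Gamma g /\ F (M ^ g)%g != 0.
  by rewrite in_fset_set // inE.
have eW g : Gamma g -> F (M ^ g)%g != 0 -> g \in W.
  by move=> h1 h2; rewrite in_fset_set // inE.
have inC g : g \in C = (g \in centralizer M) by rewrite in_fset_set.
have e1 := elliptic_Gamma_sum hM tM.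
have e2 : \sum_(g \in Gamma) F (M ^ g)%g = \sum_(g <- W) F (M ^ g)%g.
  rewrite (@fsumW _ _ [set g | Gamma g /\ F (M ^ g)%g != 0]) ?fsbig_finite //.
  by move=> g [].
pose I := [fset (M ^ g)%g | g in W]%fset.
have e3 : \sum_(N \in conj_class M) F N = \sum_(N <- I) F N.
  rewrite (@fsumW _ _ [set` I]).
  - by rewrite -fsbig_seq.
  - by move=> N /imfsetP[g /inW[hg _] ->]; exists g.
  - by move=> N [g hg <-] h; apply/imfsetP; exists g => //; exact: eW.
have fib N : N \in I -> \sum_(g <- W | (M ^ g)%g == N) F (M ^ g)%g = F N * #|` C|%:R.
  move=> /imfsetP[g0 /inW[hg0 Fg0] ->].
  rewrite (eq_bigr (fun=> F (M ^ g0)%g)) => [|g /eqP-> //].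
  rewrite big_const_seq iter_addr_0 [RHS]mulr_natr; congr (_ *+ _).
  rewrite -size_filter.
  have inj : injective (fun h : pmat => h * g0)%g.
    by move=> h h' /(congr1 (fun x => x * g0^-1)%g); rewrite -!mulgA (Gamma_unit hg0).2 !mulg1.
  rewrite -[RHS](size_map (fun h => h * g0)%g); apply/perm_size/uniq_perm.
  - by rewrite filter_uniq // fset_uniq.
  - by rewrite map_inj_uniq // fset_uniq.
  move=> g; rewrite mem_filter; apply/andP/mapP => [[/eqP eg /inW[hg Fg]]|[h hC ->]].
    have hh : Gamma (g * g0^-1)%g by apply: GammaM => //; exact: GammaV.
    exists (g * g0^-1)%g; last by rewrite -mulgA (Gamma_unit hg0).1 mulg1.
    rewrite inC inE; split=> //; apply/centralizer_conj => //.
    rewrite conj_mul ?eg //; last exact: GammaV.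
    by rewrite -conj_mul ?(Gamma_unit hg0).2 ?conj_1 //; exact: GammaV.
  have [hh ch] : centralizer M h by move: hC; rewrite inC inE.
  have e : (M ^ (h * g0) = M ^ g0)%g.
    by rewrite conj_mul //; congr (_ ^ _)%g; apply/centralizer_conj.
  by rewrite e; split=> //; apply: eW; [exact: GammaM|rewrite e].
rewrite e3; have cC : #|` C|%:R != 0 :> rat.
  rewrite pnatr_eq0 cardfs_eq0; apply/fset0Pn; exists 1%g; rewrite inC inE.
  by split; [exact: Gamma1|rewrite mul1g mulg1].
apply: (mulIf cC); rewrite mulNr mulVf // -e1 e2 [RHS](partition_big_imfset _ (fun g => M ^ g)%g).
rewrite mulr_suml; apply: eq_big_seq => N hN.
by rewrite fib.
Qed.

End EllipticSum.

(** * Flows of indefinite and semidefinite forms *)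

(* The flow of an indefinite or semidefinite form [A x^2 + B x y + C y^2] on its
   topograph: towards the river (or lake) on either side of it, and along the
   river in the direction fixed by the sign of [A - C]. *)
Definition inward (A B C : int) : bool :=
  if (0 < A) && (0 < C) then B < 0
  else if (A < 0) && (C < 0) then 0 < B
  else if (A == 0) && (C == 0) then 0 < B
  else A < C.

Lemma inward_if A B C : inward A B C =
  [|| [&& 0 < A, 0 < C & B < 0], [&& A < 0, C < 0 & 0 < B], [&& A == 0, C == 0 & 0 < B]
    | [&& ~~ ((0 < A) && (0 < C)), ~~ ((A < 0) && (C < 0)) & A < C]].
Proof.
by rewrite /inward; case: (ltrgt0P A) => hA; case: (ltrgt0P C) => hC /=; lia.
Qed.

(** Around a lake ([A = 0]) the adjacent values form an arithmetic progression of step [B]; the mark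
    sits where they pass from negative to nonnegative. It forces [B > 0], which selects one of the
    two lakes of a form with nonzero square discriminant. *)
Definition at_cusp (A B C : int) : bool := [&& A == 0, C < 0 & 0 <= B + C].

(** If [A < C], then [B + 2 A >= 0] would give [B^2 <= 4 A^2 < 4 A C]; the case [C < A] is
    symmetric. Equality would make [A + B + C > 0] contradict the discriminant. *)
Lemma indefinite_step (A B C : int) : 0 < A -> 0 < C -> 0 < A + B + C -> B < 0 ->
  4 * (A * C) <= B * B ->
  (B + 2 * A < 0 /\ 0 < B + 2 * C) \/ (0 < B + 2 * A /\ B + 2 * C < 0).
Proof.
move=> A0 C0 D0 B0 h.
have [AC|AC|AC] := ltrgtP A C.
- left; split; last by lia.
  rewrite ltNge; apply/negP => h1.
  have : B * B <= (2 * A) * (2 * A) by nia.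
  by have : A * A < A * C; [rewrite ltr_pM2l|lia].
- right; split; first by lia.
  rewrite ltNge; apply/negP => h1.
  have : B * B <= (2 * C) * (2 * C) by nia.
  by have : C * C < A * C; [rewrite ltr_pM2r|lia].
- exfalso; rewrite -AC in D0 h.
  have : (- B) * (- B) < (2 * A) * (2 * A) by apply: ltr_pM; lia.
  by rewrite mulrNN; lia.
Qed.

(** Conservation at the vertex with surrounding values [A], [C], [D], up to the marks. The other two
    triples are the form seen from the other edges of that vertex. *)
Lemma inward_div (A B C : int) (D := A + B + C) :
  4 * (A * C) <= B * B -> [|| A != 0, B != 0 | C != 0] ->
  (inward A (B + 2 * A) D + inward D (B + 2 * C) C =
   inward A B C + (at_cusp A B C + at_cusp D (C - D - A) A + at_cusp C (A - C - D) D))%N.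
Proof.
move=> h nz.
have k1 : 0 < A -> 0 < C -> 0 < D -> B < 0 ->
  (B + 2 * A < 0 /\ 0 < B + 2 * C) \/ (0 < B + 2 * A /\ B + 2 * C < 0).
  by move=> h1 h2 h3 h4; exact: indefinite_step.
have k2 : A < 0 -> C < 0 -> D < 0 -> 0 < B ->
  (B + 2 * A < 0 /\ 0 < B + 2 * C) \/ (0 < B + 2 * A /\ B + 2 * C < 0).
  move=> h1 h2 h3 h4.
  by have := @indefinite_step (- A) (- B) (- C); rewrite mulrNN mulrNN /D in h3 *; lia.
rewrite /inward /at_cusp.
move: k1 k2 nz; rewrite /D; clear; move=> k1 k2 nz.
case: (ltrgt0P A) k1 k2 nz => hA; case: (ltrgt0P C) => hC; case: (ltrgt0P (A + B + C)) => hD k1 k2 nz /=;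
  rewrite ?eqxx /= ; lia.
Qed.

(* The fixed-point form [c x^2 + (d - a) x y - b y^2], scaled by the trace to
   make its sign independent of the choice of representative modulo [+-1]. *)
Definition fixA : pmat -> int := entry_fun (fun a b c d => (a + d) * c).
Definition fixB : pmat -> int := entry_fun (fun a b c d => (a + d) * (d - a)).
Definition fixC : pmat -> int := entry_fun (fun a b c d => (a + d) * - b).

Lemma fixAE a b c d : fixA (pmx a b c d) = (a + d) * c.
Proof. by apply: entry_funE => *; ring. Qed.
Lemma fixBE a b c d : fixB (pmx a b c d) = (a + d) * (d - a).
Proof. by apply: entry_funE => *; ring. Qed.
Lemma fixCE a b c d : fixC (pmx a b c d) = (a + d) * - b.
Proof. by apply: entry_funE => *; ring. Qed.

Definition conjS (N : pmat) := (pS * N * pS)%g.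
Definition conjU (N : pmat) := (pU * (pU * N) * pU)%g.

Lemma conjSE a b c d : conjS (pmx a b c d) = pmx d (- c) (- b) a.
Proof. by rewrite /conjS S_mul mul_S -pmxN; congr pmx; lia. Qed.

Lemma conjUE a b c d : conjU (pmx a b c d) = pmx (c + d) (- c) (c + d - a - b) (a - c).
Proof. by rewrite /conjU !U_mul mul_U -pmxN; congr pmx; lia. Qed.

Lemma fix_conjS N : (fixA (conjS N) = fixC N) * (fixB (conjS N) = - fixB N) *
  (fixC (conjS N) = fixA N).
Proof.
have [a [b [c [d ->]]]] := pmx_eta N.
by rewrite conjSE !(fixAE, fixBE, fixCE); split; [split|]; ring.
Qed.

Lemma fix_conjU N : (fixA (conjU N) = fixA N + fixB N + fixC N) *
  (fixB (conjU N) = - 2 * fixA N - fixB N) * (fixC (conjU N) = fixA N).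
Proof.
have [a [b [c [d ->]]]] := pmx_eta N.
by rewrite conjUE !(fixAE, fixBE, fixCE); split; [split|]; ring.
Qed.

Definition class_flow N : rat := (inward (fixA N) (fixB N) (fixC N))%:R.
Definition cusp_mark N : rat := (at_cusp (fixA N) (fixB N) (fixC N))%:R.

Lemma fix_disc n N : detset n N -> (4 * n)%:Z <= trsq N ->
  4 * (fixA N * fixC N) <= fixB N * fixB N.
Proof.
move=> /detsetP[a [b [c [d [-> h]]]]]; rewrite trsq_pmx fixAE fixBE fixCE => ht.
rewrite -subr_ge0.
have -> : (a + d) * (d - a) * ((a + d) * (d - a)) - 4 * ((a + d) * c * ((a + d) * - b)) =
  (a + d) ^+ 2 * ((a + d) ^+ 2 - 4 * n%:Z) by rewrite -h; ring.
by rewrite mulr_ge0 ?sqr_ge0 // subr_ge0 -PoszM.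
Qed.

Lemma fix_nonscalar n N : (0 < n)%N -> detset n N -> (4 * n)%:Z <= trsq N -> ~~ scalar_pmat N ->
  [|| fixA N != 0, fixB N != 0 | fixC N != 0].
Proof.
move=> n0 /detsetP[a [b [c [d [-> h]]]]]; rewrite trsq_pmx fixAE fixBE fixCE => ht.
rewrite /pmx scalar_pmat_pm mx2_scalar; apply: contraR.
rewrite !negb_or !negbK !mulf_eq0.
have -> : (a + d == 0) = false.
  by apply/eqP => e; move: ht; rewrite e expr0n /=; lia.
by rewrite oppr_eq0 /= subr_eq0 => /and3P[-> /eqP-> ->]; rewrite eqxx.
Qed.

Lemma class_flow_div n N : (0 < n)%N -> detset n N -> (4 * n)%:Z <= trsq N -> ~~ scalar_pmat N ->
  class_flow (conjS (conjU N)) + class_flow (conjS (conjU (conjU N))) - class_flow N =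
  cusp_mark N + cusp_mark (conjU N) + cusp_mark (conjU (conjU N)).
Proof.
move=> n0 hN ht hs.
have := inward_div (fix_disc hN ht) (fix_nonscalar n0 hN ht hs).
rewrite /class_flow /cusp_mark !(fix_conjS, fix_conjU).
move: (fixA N) (fixB N) (fixC N) => A B C.
have -> : - (- 2 * A - B) = B + 2 * A by ring.
have -> : - 2 * (A + B + C) + (B + 2 * A) = A - C - (A + B + C) by ring.
have -> : - (A - C - (A + B + C)) = B + 2 * C by ring.
have -> : A + B + C + (- 2 * A - B) + A = C by ring.
have -> : - 2 * A - B = C - (A + B + C) - A by ring.
by move=> /(congr1 (fun k : nat => k%:R : rat)); rewrite !natrD; lra.
Qed.

(** Reversal exchanges [A] and [C] and negates [B]. The value [B = 0] is excluded by the
    discriminant if [A C > 0], and by nonscalarity if [A = C = 0]; in the remaining cases [A] and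
    [C] differ. *)
Lemma class_flow_S n N : (0 < n)%N -> detset n N -> (4 * n)%:Z <= trsq N -> ~~ scalar_pmat N ->
  class_flow N + class_flow (conjS N) = 1.
Proof.
move=> n0 hN ht hs.
rewrite /class_flow !fix_conjS.
have := fix_disc hN ht; have := fix_nonscalar n0 hN ht hs.
move: (fixA N) (fixB N) (fixC N) => A B C nz hd.
suff : (inward A B C + inward C (- B) A = 1)%N.
  by move=> /(congr1 (fun k : nat => k%:R : rat)); rewrite natrD.
have B0 : 0 < A * C -> B != 0 by move=> ac; apply/eqP => e; rewrite e in hd; lia.
have k1 : 0 < A -> 0 < C -> B != 0 by move=> h1 h2; apply: B0; rewrite mulr_gt0.
have k2 : A < 0 -> C < 0 -> B != 0 by move=> h1 h2; apply: B0; rewrite nmulr_rgt0.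
clear hd B0; rewrite /inward.
by case: (ltrgt0P A) k1 k2 nz => hA; case: (ltrgt0P C) => hC /= k1 k2 nz; lia.
Qed.

Lemma pos_of_mul_add (u v : int) : 0 < u * v -> 0 < u + v -> 0 < u /\ 0 < v.
Proof.
case: (ltrgt0P u) => [u0|u0|->]; last by rewrite mul0r.
  by rewrite pmulr_rgt0.
by rewrite nmulr_rgt0 // => v0 uv; exfalso; lia.
Qed.

(** With the trace bounded, [b c < 0 <= a d] and [b = c = 0] leave finitely many matrices; elsewhere
    the signs of the entries determine both sides and they agree. *)
Lemma finite_class_sg n (T : int) : (0 < n)%N ->
  finite_set [set N | detset n N /\ (trsq N = T /\ (4 * n)%:Z <= trsq N /\
    2^-1 - (Num.sg (tau N))%:~R / 2 != class_flow N)].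
Proof.
move=> n0; apply: (@finite_sub_pnorm _ (2 * `|T| + 4 * n)) => N [].
move=> /detsetP[a0 [b0 [c0 [d0 [-> h0]]]]] [].
(* With this choice of sign the factor [a + d] of [fixA], [fixB] and [fixC] becomes a positive
   scalar. *)
wlog tp : a0 b0 c0 d0 h0 / 0 <= a0 + d0.
  move=> H; case: (lerP 0 (a0 + d0)) => [|ht]; first exact: H.
  by rewrite -pmxN; apply: H; lia.
rewrite trsq_pmx => hT [ht hs].
have {}tp : 0 < a0 + d0.
  by rewrite lt_neqAle tp andbT eq_sym; apply/eqP => e; move: ht; rewrite e expr0n /=; lia.
have tT : a0 + d0 <= T by rewrite -hT expr2; move: tp; clear; nia.
move: h0 tp tT hs {hT ht}; move: a0 b0 c0 d0 => a b c d h tp tT hs.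
rewrite pnormE leqNgt; apply: contra hs => big; apply/eqP.
rewrite /class_flow fixAE fixBE fixCE tauE.
have [t et] : exists t, t = a + d by exists (a + d).
rewrite -et in tp tT *.
have -> : inward (t * c) (t * (d - a)) (t * - b) = inward c (d - a) (- b).
  rewrite /inward !pmulr_rgt0 // !pmulr_rlt0 // !mulf_eq0 ltr_pM2l //.
  by have -> : (t == 0) = false by lia.
have sgE (u : int) (e : bool) : (e /\ u < 0) \/ (~~ e /\ 0 < u) -> 2^-1 - (Num.sg u)%:~R / 2 = e%:R :> rat.
  by case=> -[he hu]; [rewrite he ltr0_sg //= | rewrite (negPf he) gtr0_sg //=]; lra.
apply: sgE; rewrite inward_if.
have [bc|bc|bc] := ltrgt0P (b * c).
- have ad : 0 < a * d by lia.
  have [a0 d0] : 0 < a /\ 0 < d by apply: pos_of_mul_add => //; lia.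
  have [c0|c0|c0] := ltrgt0P c; last by exfalso; rewrite c0 mulr0 in bc.
    have b0 : 0 < b by rewrite -(pmulr_lgt0 _ c0).
    right; split; first by lia.
    by rewrite addr_gt0 // mulr_gt0.
  have b0 : b < 0 by rewrite -(nmulr_lgt0 _ c0).
  left; split; first by lia.
  by have : a * b < 0; [rewrite pmulr_rlt0|have : c * d < 0; [rewrite pmulr_llt0|lia]].
- have [ad|ad] := ltrP (a * d) 0; last first.
    exfalso.
    have [hb hc] : (`|b| <= n)%N /\ (`|- c| <= n)%N by apply: absz_factor_le; lia.
    rewrite abszN in hc.
    have : (`|a| <= n + `|T|)%N /\ (`|d| <= n + `|T|)%N by nia.
    move: big; lia.
  have [[a0 d0]|[a0 d0]] := mulr_lt0_cases ad; have [[b0 c0]|[b0 c0]] := mulr_lt0_cases bc.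
  + right; split; first by lia.
    by rewrite addr_gt0 //; [rewrite nmulr_rgt0|rewrite mulr_gt0].
  + left; split; first by lia.
    by have : a * b < 0; [rewrite nmulr_rlt0|have : c * d < 0; [rewrite nmulr_rlt0|lia]].
  + left; split; first by lia.
    by have : a * b < 0; [rewrite pmulr_rlt0|have : c * d < 0; [rewrite pmulr_rlt0|lia]].
  + right; split; first by lia.
    by rewrite addr_gt0 //; [rewrite mulr_gt0|rewrite nmulr_rgt0].
- have ad : a * d = n%:Z by lia.
  have [ha hd] : (`|a| <= n)%N /\ (`|d| <= n)%N by apply: absz_factor_le; lia.
  have [a0 d0] : 0 < a /\ 0 < d by apply: pos_of_mul_add; lia.
  have : b = 0 \/ c = 0.
    by move/eqP: bc; rewrite mulf_eq0 => /orP[/eqP|/eqP]; [left|right].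
  case=> e0; rewrite e0.
  + have c0 : c != 0 by apply/eqP => ec; rewrite e0 ec in big; lia.
    rewrite mulr0 add0r (pmulr_llt0 _ d0) (pmulr_lgt0 _ d0); lia.
  + have b0 : b != 0 by apply/eqP => ec; rewrite e0 ec in big; lia.
    rewrite mul0r addr0 (pmulr_rlt0 _ a0) (pmulr_rgt0 _ a0); lia.
Qed.

(** * Marked elements of a class *)

Lemma conj_scalar M g : Gamma g -> scalar_pmat M -> (M ^ g)%g = M.
Proof.
have [a [b [c [d ->]]]] := pmx_eta M => /detsetP[x [y [z [w [-> h]]]]].
rewrite /pmx scalar_pmat_pm mx2_scalar => /and3P[/eqP b0 /eqP c0 /eqP ad].
rewrite -/(pmx a b c d) -/(pmx x y z w) (conj_pmx _ _ _ _ h) b0 c0 ad.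
congr pmx; [| by ring | by ring |].
  by transitivity (d * (x * w - y * z)); [ring|rewrite h mulr1].
by transitivity (d * (x * w - y * z)); [ring|rewrite h mulr1].
Qed.

Lemma conj_inv M g : Gamma g -> ((M ^ g) ^ g^-1 = M)%g.
Proof.
move=> hg; rewrite -conj_mul ?(Gamma_unit hg).2 ?conj_1 //; exact: GammaV.
Qed.

(** A normal form: upper triangular with [a < d], and [b] reduced modulo [d - a], the step by which
    conjugation by translations changes it. *)
Lemma at_cusp_form n N : (0 < n)%N -> detset n N -> (4 * n)%:Z <= trsq N ->
  at_cusp (fixA N) (fixB N) (fixC N) ->
  exists a b d : int, [/\ N = pmx a b 0 d, 0 < a + d, a * d = n%:Z, 0 < b & b <= d - a].
Proof.
move=> n0 /detsetP[a0 [b0 [c0 [d0 [-> h0]]]]].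
wlog tp : a0 b0 c0 d0 h0 / 0 <= a0 + d0.
  move=> H; case: (lerP 0 (a0 + d0)) => [|ht]; first exact: H.
  by rewrite -pmxN; apply: H; lia.
rewrite trsq_pmx => ht.
have {ht}tp : 0 < a0 + d0.
  by rewrite lt_neqAle tp andbT eq_sym; apply/eqP => e; move: ht; rewrite e expr0n /=; lia.
rewrite fixAE fixBE fixCE /at_cusp -mulrDr mulf_eq0 pmulr_rlt0 // pmulr_rge0 //.
move=> /and3P[/orP[/eqP e|/eqP e] h1 h2]; first by rewrite e in tp.
by exists a0, b0, d0; rewrite e in h0 *; split=> //; lia.
Qed.

(** Trace and determinant fix [a < d]. The conjugating element must fix the cusp, so it changes [b]
    by a multiple of [d - a], and [b] lies in a fixed system of residues. *)
Lemma at_cusp_uniq n (a b d a' b' d' : int) g : Gamma g ->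
  0 < a + d -> a * d = n%:Z -> 0 < b -> b <= d - a ->
  0 < a' + d' -> a' * d' = n%:Z -> 0 < b' -> b' <= d' - a' ->
  (pmx a b 0 d ^ g)%g = pmx a' b' 0 d' -> pmx a b 0 d = pmx a' b' 0 d'.
Proof.
move=> hg t0 ad b0 bd t0' ad' b0' bd' e.
have tt : a + d = a' + d'.
  have /eqP := trsq_conj (pmx a b 0 d) hg; rewrite e !trsq_pmx eqf_sqr.
  by case/orP => /eqP; lia.
have dd : d - a = d' - a'.
  have /eqP : (d - a) ^+ 2 = (d' - a') ^+ 2.
    have E (u v : int) : (v - u) ^+ 2 = (u + v) ^+ 2 - 4 * (u * v) by ring.
    by rewrite !E tt ad ad'.
  by rewrite eqf_sqr => /orP[] /eqP; lia.
have [ea ed] : a' = a /\ d' = d by lia.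
subst a' d'.
move: hg e => /detsetP[x [y [z [w [-> hg]]]]]; rewrite (conj_pmx _ _ _ _ hg) !mul0r !add0r.
case/pmxP=> -[e1 e2 e3 e4]; last first.
  exfalso; have : a + d = - (a + d); last by lia.
  transitivity ((a + d) * (x * w - y * z)); first by rewrite hg mulr1.
  by rewrite opprD -e1 -e4; ring.
(* Otherwise both columns of [g] would be eigenvectors for the eigenvalue [d], contrary to their
   independence. *)
have z0 : z = 0.
  apply/eqP; apply: contraT => z0; exfalso.
  have f1 : x * (d - a) - b * z = 0.
    apply/eqP; have /eqP := e3; rewrite (_ : _ - _ = z * (x * (d - a) - b * z)); last by ring.
    by rewrite mulf_eq0 (negPf z0).
  have f2 : y * (d - a) - b * w = 0.
    apply/eqP; have : z * (y * (d - a) - b * w) = 0.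
      transitivity (x * (d * w) - z * (a * y + b * w) - d * (x * w - y * z)); first by ring.
      by rewrite e4 hg mulr1 subrr.
    by move/eqP; rewrite mulf_eq0 (negPf z0).
  have : (d - a) * (x * w - y * z) = 0.
    transitivity (w * (x * (d - a) - b * z) - z * (y * (d - a) - b * w)); first by ring.
    by rewrite f1 f2 !mulr0 subrr.
  by rewrite hg mulr1; lia.
congr pmx; rewrite z0 mulr0 subr0 in hg.
have [[_ w1]|[_ w1]] := mulz_eq1 hg; rewrite w1 in e2.
  have : b - b' = y * (d - a) by lia.
  have [y0|[y0|y0]] : y = 0 \/ 1 <= y \/ y <= -1 by lia.
  - by rewrite y0; lia.
  - have : d - a <= y * (d - a) by rewrite -[leLHS]mul1r ler_wpM2r //; lia.
    lia.
  - have : y * (d - a) <= -1 * (d - a) by rewrite ler_wpM2r //; lia.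
    lia.
have : b' - b = y * (d - a) by lia.
have [y0|[y0|y0]] : y = 0 \/ 1 <= y \/ y <= -1 by lia.
- by rewrite y0; lia.
- have : d - a <= y * (d - a) by rewrite -[leLHS]mul1r ler_wpM2r //; lia.
  lia.
- have : y * (d - a) <= -1 * (d - a) by rewrite ler_wpM2r //; lia.
  lia.
Qed.

Lemma primitive_vector (u v : int) : (u != 0) || (v != 0) ->
  exists m x z y w : int, [/\ m != 0, u = m * x, v = m * z & x * w - y * z = 1].
Proof.
move=> uv; have m0 : gcdz u v != 0 by rewrite gcdz_eq0 negb_and.
have [s [t e]] := Bezoutz u v.
have /dvdzP[x ex] := dvdz_gcdl u v; have /dvdzP[z ez] := dvdz_gcdr u v.
move: (gcdz u v) m0 e ex ez => m m0 e ex ez.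
exists m, x, z, (- t), s; split=> //; [by rewrite mulrC|by rewrite mulrC|].
by apply: (mulIf m0); rewrite mul1r -[RHS]e ex ez; ring.
Qed.

(** The eigenvalues [a1 < a1 + k] are integers. Completing a primitive eigenvector for [a1] to an
    element of [Gamma] makes [M] upper triangular, and a translation then reduces the upper right
    entry. *)
Lemma split_cusp n M (k : int) : (0 < n)%N -> detset n M -> (4 * n)%:Z < trsq M ->
  trsq M - (4 * n)%:Z = k ^+ 2 ->
  exists2 g, Gamma g & at_cusp (fixA (M ^ g)%g) (fixB (M ^ g)%g) (fixC (M ^ g)%g).
Proof.
move=> n0 /detsetP[a [b [c [d [-> h]]]]].
wlog tp : a b c d h / 0 <= a + d.
  move=> H; case: (lerP 0 (a + d)) => [|ht]; first exact: H.
  by rewrite -pmxN; apply: H; lia.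
wlog kp : k / 0 <= k.
  move=> H h1 h2; case: (lerP 0 k) => [|hk]; first by move/H; apply.
  by apply: (H (- k)); rewrite ?sqrrN //; lia.
rewrite trsq_pmx => hT hk.
have k0 : 0 < k.
  by rewrite lt_neqAle kp andbT eq_sym; apply/eqP => e; move: hk; rewrite e expr0n /=; lia.
have {}tp : 0 < a + d.
  by rewrite lt_neqAle tp andbT eq_sym; apply/eqP => e; move: hT; rewrite e expr0n /=; lia.
have fact : (a + d - k) * (a + d + k) = 4 * n%:Z.
  by transitivity ((a + d) ^+ 2 - k ^+ 2); [ring|rewrite -hk; lia].
(* The factors in [fact] have the same parity and an even product. *)
have [a1 ea1] : exists a1, a + d = 2 * a1 + k.
  have [r [er|er]] : exists r, a + d - k = 2 * r \/ a + d - k = 2 * r + 1.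
  - by exists ((a + d - k) %/ 2)%Z; lia.
  - by exists r; lia.
  - exfalso; have e2 : a + d + k = 2 * (r + k) + 1 by lia.
    by move: fact; rewrite er e2; lia.
have ad1 : a1 * (a1 + k) = n%:Z.
  by move: fact; rewrite ea1; lia.
have sing : (a - a1) * (d - a1) - b * c = 0.
  transitivity (a * d - b * c - a1 * (a + d - a1)); first by ring.
  by rewrite h ea1 -ad1; ring.
(* A kernel vector of [M - a1], read off the first row, or off the second if the first is zero; in
   that case [d - a1 = k] is nonzero. *)
have [u [v [uv e1 e2]]] : exists u v : int, [/\ (u != 0) || (v != 0),
    (a - a1) * u + b * v = 0 & c * u + (d - a1) * v = 0].
  have [bz|bz] := boolP ((b != 0) || (a1 - a != 0)).
    exists b, (a1 - a); split=> //; first by ring.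
    by rewrite -[RHS]oppr0 -sing; ring.
  move: bz; rewrite negb_or !negbK subr_eq0 => /andP[/eqP b0 /eqP ea].
  exists (d - a1), (- c); split; [by apply/orP; left; lia| |by ring].
  by rewrite b0 ea; ring.
have [m [x [z [y [w [m0 eu ev hg]]]]]] := primitive_vector uv.
have {}e1 : a * x + b * z = a1 * x.
  apply: (mulfI m0); apply/eqP; rewrite -subr_eq0; apply/eqP.
  by rewrite -[RHS]e1 eu ev; ring.
have {}e2 : c * x + d * z = a1 * z.
  apply: (mulfI m0); apply/eqP; rewrite -subr_eq0; apply/eqP.
  by rewrite -[RHS]e2 eu ev; ring.
have Gg : Gamma (pmx x y z w) by apply/detset_pmx.
pose b1 := w * (a * y + b * w) - y * (c * y + d * w).
have eN : (pmx a b c d ^ pmx x y z w)%g = pmx a1 b1 0 (a1 + k).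
  rewrite (conj_pmx _ _ _ _ hg) e1 e2; congr pmx; [|by ring|].
    by transitivity (a1 * (x * w - y * z)); [ring|rewrite hg mulr1].
  have e3 : w * (a1 * x) - y * (a1 * z) = a1.
    by transitivity (a1 * (x * w - y * z)); [ring|rewrite hg mulr1].
  have : a1 + (x * (c * y + d * w) - z * (a * y + b * w)) = a + d; last by lia.
  rewrite -{1}e3 -e1 -e2.
  by transitivity ((a + d) * (x * w - y * z)); [ring|rewrite hg mulr1].
(* Dividing [b1 - 1] instead of [b1] leaves an upper right entry between 1 and [k]. *)
pose j := ((b1 - 1) %/ k)%Z.
have Gj : Gamma (pmx 1 j 0 1) by apply/detset_pmx; lia.
exists (pmx x y z w * pmx 1 j 0 1)%g; first exact: GammaM.
have eT : (pmx a1 b1 0 (a1 + k) ^ pmx 1 j 0 1)%g = pmx a1 (b1 - j * k) 0 (a1 + k).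
  by rewrite conj_pmx; [congr pmx; ring|lia].
rewrite conj_mul // eN eT fixAE fixBE fixCE.
have ej : b1 - 1 = j * k + ((b1 - 1) %% k)%Z := divz_eq _ _.
have rk : ((b1 - 1) %% k)%Z < k by apply: ltz_pmod.
have r0' : 0 <= ((b1 - 1) %% k)%Z by apply: modz_ge0; lia.
move: ((b1 - 1) %% k)%Z ej rk r0' => r ej rk r0'.
have t0 : 0 < a1 + (a1 + k) by lia.
rewrite /at_cusp -mulrDr mulr0 eqxx pmulr_rlt0 // pmulr_rge0 //.
lia.
Qed.

(** * Sums over nonscalar, nonelliptic classes *)

Section ClassSum.
Variables (n : nat) (n_gt0 : (0 < n)%N) (F G : pmat -> rat).
Hypothesis FG : flow_spec n F G.
Let F_fin := flow_finite FG.
Let G_fin := flow_at_infinity FG.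
Let G_S := flow_reverse FG.
Let G_Sl := flow_edge FG.
Let G_div_conj := flow_div_conj FG.

Variables (M : pmat) (hM : detset n M) (tM : (4 * n)%:Z <= trsq M) (nsM : ~~ scalar_pmat M).
Let X := conj_class M.

Let XP N : X N -> [/\ detset n N, trsq N = trsq M & ~~ scalar_pmat N].
Proof.
move=> [g hg <-]; split; [exact: conj_det|exact: trsq_conj|].
by apply: contra nsM => h; have := conj_scalar (GammaV hg) h; rewrite conj_inv // => ->.
Qed.

Let X_conj N g : Gamma g -> X N -> X (N ^ g)%g.
Proof. by move=> hg [h hh <-]; exists (h * g)%g; [exact: GammaM|exact: conj_mul]. Qed.

Let X_S N : X N -> X (conjS N). Proof. by move=> /(X_conj GammaS); rewrite conj_S. Qed.
Let X_U N : X N -> X (conjU N). Proof. by move=> /(X_conj GammaU); rewrite conj_U. Qed.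

Let bij_S : set_bij X X conjS.
Proof.
have K N : conjS (conjS N) = N.
  by have [a [b [c [d ->]]]] := pmx_eta N; rewrite !conjSE !opprK.
exact: (@set_bij_can _ _ _ conjS).
Qed.

Let UUU N : conjU (conjU (conjU N)) = N.
Proof. by have [a [b [c [d ->]]]] := pmx_eta N; rewrite !conjUE; congr pmx; lia. Qed.

Let bij_U : set_bij X X conjU.
Proof.
by apply: (@set_bij_can _ _ _ (fun N => conjU (conjU N))) => // N /X_U/X_U.
Qed.

Let conjUU N : conjU (conjU N) = (pU * N * pU * pU)%g.
Proof. by rewrite /conjU -!mulgA UUUl. Qed.

(** Centralizers may be infinite here, so [fsum_flow] is applied on the class itself instead of on
    [Gamma]. Each mark is counted from three edges, which cancels the factor 3. *)
Lemma class_sum_marks : fin_supp X cusp_mark ->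
  \sum_(N \in X) F N = \sum_(N \in X) cusp_mark N.
Proof.
move=> fm.
have XF : fin_supp X F by apply: sub_finite_set F_fin => N [/XP[hN _ _]].
have : \sum_(N \in X) (class_flow (conjS (conjU N)) + class_flow (conjS (conjU (conjU N))) -
    class_flow N) = 3 * \sum_(N \in X) F N.
  apply: (@fsum_flow _ X conjS conjU F G class_flow bij_S bij_U) => //.
  - by move=> N /XP[hN _ _]; rewrite conjUU; apply: G_div_conj.
  - by move=> N /XP[hN _ _]; rewrite /conjS -mulgA G_Sl; [exact: G_S|exact: GammaMr GammaS _].
  - by move=> N /XP[hN tN sN]; apply: (class_flow_S n_gt0) => //; rewrite tN.
  have := finite_class_sg (trsq M) n_gt0.
  move: G_fin; set E1 := (Y in finite_set Y -> _); set E2 := (Y in _ -> finite_set Y -> _) => f1 f2.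
  apply: (@sub_finite_set _ _ (E1 `|` E2)%classic); last by rewrite finite_setU.
  move=> N [/XP[hN tN _] hne].
  have [e|] := eqVneq (G N) (2^-1 - (Num.sg (tau N))%:~R / 2); last by left.
  by right; split=> //; rewrite tN -e.
have m1 : has_fsum X cusp_mark (\sum_(N \in X) cusp_mark N) by [].
have m2 := has_fsum_bij bij_U m1.
have m3 := has_fsum_bij bij_U m2.
have [_ e3] := has_fsumD (has_fsumD m1 m2) m3.
rewrite (eq_fsbigr (fun N => cusp_mark N + cusp_mark (conjU N) + cusp_mark (conjU (conjU N)))).
  by rewrite e3; lra.
move=> N /set_mem /XP[hN tN sN]; apply: (class_flow_div n_gt0) => //; by rewrite tN.
Qed.

Lemma cusp_mark_uniq N N' : X N -> X N' -> cusp_mark N != 0 -> cusp_mark N' != 0 -> N = N'.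
Proof.
have cm P : cusp_mark P != 0 -> at_cusp (fixA P) (fixB P) (fixC P).
  by rewrite /cusp_mark pnatr_eq0 eqb0 negbK.
move=> XN XN' /cm + /cm.
have [hN tN _] := XP XN; have [hN' tN' _] := XP XN'.
move=> /(at_cusp_form n_gt0 hN); rewrite tN => /(_ tM) [a [b [d [eN h1 h2 h3 h4]]]].
move=> /(at_cusp_form n_gt0 hN'); rewrite tN' => /(_ tM) [a' [b' [d' [eN' h1' h2' h3' h4']]]].
move: XN XN' => [g hg eg] [g' hg' eg'].
rewrite eN eN'; apply: (@at_cusp_uniq n _ _ _ _ _ _ (g^-1 * g')%g) => //.
  by apply: GammaM => //; apply: GammaV.
rewrite -eN -eN' conj_mul //; last exact: GammaV.
by rewrite -eg conj_inv.
Qed.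

(** There is exactly one marked element if the discriminant is a nonzero square, by [split_cusp] and
    [cusp_mark_uniq]. Otherwise there is none, since a mark gives the discriminant
    [(d - a)^2 > 0]. *)
Lemma class_sum : \sum_(N \in X) F N = weight n M.
Proof.
rewrite /weight (negPf nsM) ltNge tM /=.
have cm P : cusp_mark P != 0 -> at_cusp (fixA P) (fixB P) (fixC P).
  by rewrite /cusp_mark pnatr_eq0 eqb0 negbK.
case: ifP => [/andP[tgt /asboolP[k hk]]|nsplit].
  have [g hg cg] := split_cusp n_gt0 hM tgt hk.
  have Xg : X (M ^ g)%g by exists g.
  have c1 : cusp_mark (M ^ g)%g = 1 by rewrite /cusp_mark cg.
  have sub N : X N -> cusp_mark N != 0 -> N = (M ^ g)%g.
    by move=> XN mN; apply: cusp_mark_uniq => //; rewrite c1 oner_neq0.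
  rewrite class_sum_marks; last first.
    by apply: (@sub_finite_set _ _ [set (M ^ g)%g]); [move=> N [XN /(sub _ XN)]|exact: finite_set1].
  by rewrite (@fsumW _ _ [set (M ^ g)%g]) ?fsbig_set1 // => N ->.
have no N : X N -> cusp_mark N = 0.
  move=> XN; apply/eqP; apply: contraFT nsplit => /cm.
  have [hN tN _] := XP XN.
  move=> /(at_cusp_form n_gt0 hN); rewrite tN => /(_ tM) [a [b [d [eN h1 h2 h3 h4]]]].
  have e : trsq M - (4 * n)%:Z = (d - a) ^+ 2.
    by rewrite -tN eN trsq_pmx PoszM -h2; ring.
  apply/andP; split; last by apply/asboolP; exists (d - a).
  by rewrite -subr_gt0 e exprn_gt0 //; lia.
rewrite class_sum_marks; first by apply: fsbig1 => N /no.
by apply: sub_finite_set (finite_set0 pmat) => N [/no ->]; rewrite eqxx.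
Qed.

End ClassSum.

(** * Scalar classes and the assembly of all cases *)

Lemma finite_neqD n (f g h : pmat -> rat) :
  finite_set [set N | detset n N /\ f N != 0] ->
  finite_set [set N | detset n N /\ g N != h N] ->
  finite_set [set N | detset n N /\ f N + g N != h N].
Proof.
move=> ff fg; pose E1 := [set N | detset n N /\ f N != 0]%classic.
pose E2 := [set N | detset n N /\ g N != h N]%classic.
apply: (@sub_finite_set _ _ (E1 `|` E2)%classic); last by rewrite finite_setU.
move=> N [hN]; have [->|] := eqVneq (f N) 0; last by left.
by rewrite add0r; right.
Qed.

Lemma scalar_class_sum n (F : pmat -> rat) M :
  (forall N, detset n N -> (N * pS = pS * N)%g -> (N * pU = pU * N)%g -> F N = 6^-1) ->
  detset n M -> scalar_pmat M -> \sum_(N \in conj_class M) F N = 6^-1.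
Proof.
move=> FE hM sM; have cM g : Gamma g -> (M * g)%g = (g * M)%g.
  by move=> hg; symmetry; apply/centralizer_conj => //; exact: conj_scalar.
rewrite (_ : conj_class M = [set M]%classic); last first.
  apply/seteqP; split=> [N [g hg <-]|N ->] /=; first exact: conj_scalar.
  by exists 1%g; [exact: Gamma1|exact: conj_1].
by rewrite fsbig_set1; apply: FE => //; apply: cM; [exact: GammaS|exact: GammaU].
Qed.

Theorem theorem1 (n : nat) (n_gt0 : (0 < n)%N) (D : {fset pmat})
  (D_reps : infty_reps n D) (Tn : QM) (Tn_in : Rn n Tn)
  (Tn_A : conditionA n D Tn) (Tn_B : conditionB n Tn) :
  (forall M0 : pmat, detset n M0 -> pairing Tn (right_coset M0) = -1) /\
  (forall M0 : pmat, detset n M0 -> pairing Tn (conj_class M0) = weight n M0).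
Proof.
case: Tn_A => xi _ eA; case: Tn_B => -[xi1 _ eB1] [xi2 _ eB2].
(* Adding [cusp_sign] absorbs [T_n^oo (1 - S)], so that (A) becomes [(1 - S) F = (1 - T) eta] for an
   [eta] of infinite support but known behaviour at infinity. *)
pose F N := Tn@_N; pose eta N := xi@_N + cusp_sign D N.
have F_fin : finite_set [set N | detset n N /\ F N != 0] by exact: Rn_fin.
have eta_fin : finite_set [set N | detset n N /\ eta N != (Num.sg (tau N))%:~R / 2].
  exact: finite_neqD (Rn_fin n xi) (cusp_sign_fin n_gt0 D_reps).
have F_eta N : detset n N ->
    F N - F (pS * N)%g = eta N - eta (pmx 1 (-1) 0 1 * N)%g.
  move=> hN; have := condA_coef eA N; have := cusp_sign_T n_gt0 D_reps hN.
  rewrite -/(F N) -/(F (pS * N)%g) /eta.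
  by move: (F _) (F _) (xi@_N) (xi@__) (cusp_sign _ _) (cusp_sign _ _) => *; lra.
have F_S N (_ : detset n N) := condB_S eB1 N.
have F_U N (_ : detset n N) := condB_U eB2 N.
have FG := side_flowP n_gt0 F_fin eta_fin F_eta F_S F_U.
split=> M hM; first exact: (coset_sum n_gt0 FG).
have [sM|nsM] := boolP (scalar_pmat M).
  rewrite /weight sM; apply: (scalar_class_sum _ hM sM) => N hN.
  exact: (coef_scalar n_gt0 F_fin eta_fin F_eta F_S F_U).
have [tM|tM] := ltrP (trsq M) (4 * n)%:Z; last exact: (class_sum n_gt0 FG).
by rewrite /weight (negPf nsM) tM; exact: (elliptic_class_sum FG hM tM).
Qed.
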